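(* Fix an integer $d\ge 1$. For quasiconcave $\phi$-smooth instances, the smoothed number of Pareto-optimal solutions is $O\big(n^{2d}\phi^d\big)$, where the constant hidden in the $O$-notation depends only on $d$.
   Context: Multiobjective binary optimization model: an instance consists of a set $\mathcal{S}\subseteq\{0,1\}^n$ of feasible solutions and $d+1$ objective functions to be minimized. The last one $V^{d+1}\colon\mathcal{S}\to\mathbb{R}$ is arbitrary; the first $d$ are linear, $V^t(x)=\sum_{i=1}^n V^t_i x_i$ for $t\in[d]$. A solution $x\in\mathcal{S}$ is Pareto-optimal if there is no $y\in\mathcal{S}$ with $V^t(y)\le V^t(x)$ for all $t\in[d+1]$ and $V^t(y)<V^t(x)$ for at least one $t$; $\mathrm{PO}(V)$ is the number of Pareto-optimal solutions for coefficient matrix $V=(V^t_i)\in\mathbb{R}^{d\times n}$. Quasiconcave $\phi$-smooth instances ($\phi\ge1$): an adversary chooses $\mathcal{S}$, $V^{d+1}$, and for each coefficient $V^t_i$ a density $f^t_i\colon[-1,1]\to[0,\phi]$ that is quasiconcave (there is $x^t_i\in[-1,1]$ such that $f^t_i$ is non-decreasing on $[-1,x^t_i]$ and non-increasing on $[x^t_i,1]$); each $V^t_i$ is drawn independently according to $f^t_i$. The smoothed number of Pareto-optimal solutions is the supremum over all such adversarial choices of $\mathbb{E}_V[\mathrm{PO}(V)]$. *)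

(* Defs.v *)
From HB Require Import structures.
From mathcomp Require Import all_boot all_order all_algebra.
From mathcomp Require Import all_classical all_reals all_analysis.
Import Order.TTheory GRing.Theory Num.Theory.
Import numFieldNormedType.Exports.

Set Implicit Arguments.
Unset Strict Implicit.
Unset Printing Implicit Defensive.

Local Open Scope classical_set_scope.
Local Open Scope ring_scope.

Notation binvec n := {ffun 'I_n -> bool}.

Section pareto.
Context {R : realType} {d n : nat}.

(* The d + 1 objectives are indexed by 'I_d.+1, the last index ord_max being
   the arbitrary one.  Vlast is defined on all of {0,1}^n, but only its values
   on the feasible set matter below. *)
Definition objective (V : 'M[R]_(d, n)) (Vlast : binvec n -> R)
    (t : 'I_d.+1) (x : binvec n) : R :=
  if unlift ord_max t is Some s then \sum_(i < n) V s i * (x i)%:R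
  else Vlast x.

Definition dominates V Vlast (y x : binvec n) : bool :=
  [forall t, objective V Vlast t y <= objective V Vlast t x] &&
  [exists t, objective V Vlast t y < objective V Vlast t x].

Definition pareto_optimal (S : {set binvec n}) V Vlast (x : binvec n) : bool :=
  (x \in S) && ~~ [exists y in S, dominates V Vlast y x].

Definition PO (S : {set binvec n}) Vlast V : nat :=
  #|[pred x | pareto_optimal S V Vlast x]|.

End pareto.

Section smoothed.
Context {R : realType}.

Definition quasiconcave (f : R -> R) : Prop :=
  exists2 c : R, c \in `[-1, 1] &
    {in `[-1, c] &, {homo f : a b / a <= b}} /\
    {in `[c, 1] &, {homo f : a b / a <= b >-> b <= a}}.

(* Functions [-1, 1] -> [0, phi] are functions on R of which only the
   restriction to [-1, 1] is used. *)
Definition quasiconcave_density (phi : R) (f : R -> R) : Prop :=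
  [/\ measurable_fun (`[-1, 1] : set R) f,
      forall x, x \in `[-1, 1] -> 0 <= f x <= phi,
      (\int[lebesgue_measure]_(x in `[(-1)%R, 1%R]) (f x)%:E = 1)%E
    & quasiconcave f].

Definition has_density d (T : measurableType d) (P : probability T R)
    (X : {RV P >-> R}) (f : R -> R) : Prop :=
  forall A : set R, measurable A ->
    (distribution P X A =
      \int[lebesgue_measure]_(x in `[(-1)%R, 1%R] `&` A) (f x)%:E)%E.

Definition mutually_independent d (T : measurableType d) (P : probability T R)
    (I : finType) (X : I -> {RV P >-> R}) : Prop :=
  forall (J : {set I}) (A : I -> set R), (forall i, measurable (A i)) ->
    (P (\bigcap_(i in [set` J]) (X i @^-1` A i)) =
      \prod_(i in J) P (X i @^-1` A i))%E.

(* The expectation depends on the random coefficients only through their joint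
   law, hence not on the probability space that carries them. *)
Definition smoothed_number_PO (d n : nat) (phi : R) : \bar R :=
  ereal_sup [set e | exists (S : {set binvec n}) (Vlast : binvec n -> R)
      (f : 'I_d -> 'I_n -> R -> R)
      (disp : measure_display) (T : measurableType disp)
      (P : probability T R) (V : 'I_d -> 'I_n -> {RV P >-> R}),
    [/\ forall t i, quasiconcave_density phi (f t i),
        forall t i, has_density (V t i) (f t i),
        mutually_independent (fun ti : 'I_d * 'I_n => V ti.1 ti.2)
      & e = 'E_P[fun w => (PO S Vlast (\matrix_(t, i) V t i w))%:R]%E]].

End smoothed.

(* Main.v *)
(** Round the coefficients to multiples of [1/N], with [N] large: up to an event
of small probability the rounded integer matrix [W] keeps linear objectives of
different solutions more than [n] apart, and a Pareto-optimal solution remains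
unbeaten for [W].

For such a solution [x], run the witness procedure of Moitra-O'Donnell and
Brunsch-Roeglin.  With objectives [0..d] ([d] being the arbitrary one) and for
[t = d, ..., 1], let [y_t] minimise objective [t] among the remaining solutions
that beat [x] in the objectives [r < t]; choose an index [i_t] at which [y_t]
and [x] differ, and keep only the solutions that agree with [x] at [i_t] and
beat [y_t] in objective [t].  Finally [x = y_0] minimises objective [0].  The
indices, the bits of all [y_j] at them and one flag per step form a certificate;
there are [O(n^d)] of them.

A certificate determines, for every row [r], an integer direction [v_r] with
[v_r . y_j = [j <= r]] up to a constant depending on [r] only.  So the
comparisons made by the procedure do not change when [W] is moved along these
directions, and on each coset of the lattice they span a solution with this
certificate is determined by its vector of objective values: a coset contains
at most [O((n N)^d)] pairs (matrix, certified solution).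

It remains to sum, over the cosets, the largest probability of a matrix in the
coset.  On a line this maximum is at most the sum of the decrements, and the
total variation of a product of unimodal mass functions bounded by [phi / N] is
[O(phi / N)] per row.  This yields [O(n^d (n N)^d (phi / N)^d)]. *)

Require Import Defs.
From HB Require Import structures.
From mathcomp Require Import all_boot all_order all_algebra.
From mathcomp Require Import all_classical all_reals all_analysis.
From mathcomp Require Import measurable_realfun zify ring lra.
Import Order.TTheory GRing.Theory Num.Theory.
Local Open Scope ring_scope.

Set Implicit Arguments.
Unset Strict Implicit.
Unset Printing Implicit Defensive.

(** * Witness certificates *)

Section Certificate.
Variables (n d : nat) (S : {set binvec n}).
Implicit Types (ob : nat -> binvec n -> int) (x z : binvec n).

(* Step [t = k.+1] of the procedure chose the index [i k] and the witness [y t].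
   [fl t] is false when no solution was available at step [t]: then [y t] is a
   dummy, namely [x] flipped at a fresh index, and imposes no inequality. *)
Definition in_residual ob x (i : nat -> 'I_n) (y : nat -> binvec n) (fl : nat -> bool)
    t z : Prop :=
  z \in S /\ forall k, (t <= k < d)%N ->
    z (i k) = x (i k) /\ (fl k.+1 -> ob k.+1 z < ob k.+1 (y k.+1)).

Definition competitor ob x i y (fl : nat -> bool) t z : Prop :=
  in_residual ob x i y fl t z /\ forall r, (r < t)%N -> ob r z < ob r x.

Definition is_min ob x i y (fl : nat -> bool) t : Prop :=
  competitor ob x i y fl t (y t) /\
  forall z, competitor ob x i y fl t z -> ob t (y t) <= ob t z.

(** The bit conditions say that [y j] agrees with [x] at the indices of all steps run before step
    [j], and that [y k.+1] differs from [x] at [i k]. They make the matrix of bits triangular. *)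
Definition certificate ob x i y (fl : nat -> bool) : Prop :=
  [/\ y 0%N = x, fl 0%N,
      forall j k, (j <= k < d)%N -> y j (i k) = x (i k),
      forall k, (k < d)%N -> y k.+1 (i k) = ~~ x (i k)
    & forall t, (t <= d)%N -> fl t -> is_min ob x i y fl t].

(* [A j k] is the common bit of [y1 j] and [y2 j] at [i k].  Both procedures take
   the same decisions, from step [d] down to step [0], where [y 0 = x]. *)
Lemma reconstruction (A : nat -> nat -> bool) i fl ob1 ob2 x1 x2 y1 y2 :
  (forall t, (t <= d)%N -> injective (ob1 t)) ->
  certificate ob1 x1 i y1 fl -> certificate ob2 x2 i y2 fl ->
  (forall j k, (j <= d)%N -> (k < d)%N -> y1 j (i k) = A j k) ->
  (forall j k, (j <= d)%N -> (k < d)%N -> y2 j (i k) = A j k) ->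
  (forall r j j' z z', (r <= d)%N -> (j <= r)%N -> (j' <= r)%N ->
     (forall k, (k < d)%N -> z (i k) = A j k) ->
     (forall k, (k < d)%N -> z' (i k) = A j' k) ->
     (ob1 r z < ob1 r z') = (ob2 r z < ob2 r z')) ->
  (forall r j z, (r < j <= d)%N -> (forall k, (k < d)%N -> z (i k) = A j k) ->
     (ob1 r z < ob1 r x1) = (ob2 r z < ob2 r x2)) ->
  x1 = x2.
Proof.
move=> inj1 [y10 fl0 _ _ m1] [y20 _ _ _ m2] A1 A2 H1 H2.
have xx k : (k < d)%N -> x1 (i k) = x2 (i k).
  by move=> kd; rewrite -y10 -y20 A1 // A2.
(* Downward induction on the step: witnesses with a true flag coincide, and the others impose no
   inequality. *)
suff E m t : (d - t <= m)%N -> (t <= d)%N -> fl t -> y1 t = y2 t.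
  by rewrite -y10 -y20; apply: (E d) => //; rewrite subn0.
elim: m t => [|m IH] t.
  move=> dt td flt; have {dt td} tE : t = d by lia.
  subst t.
  have [[[S1 R1] C1] M1] := m1 _ (leqnn _) flt.
  have [[[S2 R2] C2] M2] := m2 _ (leqnn _) flt.
  apply: (inj1 d (leqnn _)); apply/eqP; rewrite eq_le; apply/andP; split.
    apply: M1; split; first by split => // k; lia.
    move=> r rd; rewrite (H2 _ d) ?rd ?leqnn//; first exact: C2.
    by move=> k kd; rewrite A2.
  rewrite leNgt (H1 _ d d) ?leqnn//; last 2 first.
  - by move=> k kd; rewrite A1.
  - by move=> k kd; rewrite A2.
  rewrite -leNgt; apply: M2; split; first by split => // k; lia.
  move=> r rd; rewrite -(H2 _ d) ?rd ?leqnn//; first exact: C1.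
  by move=> k kd; rewrite A1.
move=> dt td flt.
have [[[S1 R1] C1] M1] := m1 _ td flt.
have [[[S2 R2] C2] M2] := m2 _ td flt.
have a1 k : (k < d)%N -> y1 t (i k) = A t k by move=> kd; rewrite A1.
have a2 k : (k < d)%N -> y2 t (i k) = A t k by move=> kd; rewrite A2.
have eqy k : (t <= k < d)%N -> fl k.+1 -> y1 k.+1 = y2 k.+1.
  by move=> tk flk; apply: IH => //; lia.
(* Each minimiser is a competitor in the other run, so neither is smaller, and injectivity
   identifies them. *)
apply: (inj1 t td); apply/eqP; rewrite eq_le; apply/andP; split.
  apply: M1; split.
    split => // k tkd; have [e h] := R2 _ tkd; split.
      by rewrite e xx //; lia.
    move=> flk; rewrite (H1 _ t k.+1) ?(eqy k)//; [exact: h| lia|lia|].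
    by move=> l ld; rewrite A2//; lia.
  move=> r rt; rewrite (H2 _ t) ?rt//; exact: C2.
rewrite leNgt (H1 _ t t) // -leNgt; apply: M2; split.
  split => // k tkd; have [e h] := R1 _ tkd; split.
    by rewrite e xx //; lia.
  move=> flk; rewrite -(H1 _ t k.+1) -?(eqy k)//; [exact: h| lia|lia|].
  by move=> l ld; rewrite A1//; lia.
move=> r rt; rewrite -(H2 _ t) ?rt//; exact: C1.
Qed.

Definition update (T : Type) (f : nat -> T) t a : nat -> T :=
  fun s => if s == t then a else f s.

Lemma update_same T (f : nat -> T) t a : update f t a t = a.
Proof. by rewrite /update eqxx. Qed.
Lemma update_other T (f : nat -> T) t a s : s != t -> update f t a s = f s.
Proof. by rewrite /update => /negPf ->. Qed.

Lemma certificate_exists ob x :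
  (0 < n)%N -> (d <= n)%N -> x \in S ->
  (forall t, (t <= d)%N -> injective (ob t)) ->
  (forall z, z \in S -> (forall r, (r < d)%N -> ob r z < ob r x) ->
     ob d x <= ob d z) ->
  exists i y fl, certificate ob x i y fl.
Proof.
move=> n0 dn xS inj pareto.
(* State once the steps above [t] are done: [x] is still in the residual set and minimises objective
   [t] among the residual solutions that beat it below [t]. At [t = d] this is the Pareto
   hypothesis, at [t = 0] the minimality of [x] in objective 0. *)
pose good t i y fl := [/\ (in_residual ob x i y fl t x),
  (forall z, in_residual ob x i y fl t z -> (forall r, (r < t)%N -> ob r z < ob r x) ->
     ob t x <= ob t z),
  (forall j k, (t < j <= k)%N -> (k < d)%N -> y j (i k) = x (i k)),
  (forall k, (t <= k < d)%N -> y k.+1 (i k) = ~~ x (i k))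
  & (forall s, (t < s <= d)%N -> fl s -> is_min ob x i y fl s)].
have main m : (m <= d)%N -> exists i y fl, good (d - m)%N i y fl.
  elim: m => [_|m IH md].
    exists (fun _ => Ordinal n0), (fun _ => x), (fun _ => false).
    rewrite subn0; split.
    - by split => // k; lia.
    - by move=> z [zS _]; apply: pareto.
    - by move=> j k; lia.
    - by move=> k; lia.
    - by move=> s; lia.
  have [i [y [fl]]] := IH (ltnW md).
  set t1 := (d - m)%N; set t := (d - m.+1)%N.
  have t1E : t1 = t.+1 by lia.
  have td : (t < d)%N by lia.
  rewrite t1E => -[Rx inv Pj Pk Pm].
  suff [it [yt [ft [Ex Ek Et Ef]]]] : exists it (yt : binvec n) (ft : bool),
      [/\ yt it = ~~ x it,
          forall k, (t < k < d)%N -> yt (i k) = x (i k),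
          ft -> competitor ob x i y fl t.+1 yt /\
                forall z, competitor ob x i y fl t.+1 z -> ob t.+1 yt <= ob t.+1 z
        & ~~ ft -> forall z, ~ competitor ob x i y fl t.+1 z].
    pose i' := update i t it; pose y' := update y t.+1 yt; pose fl' := update fl t.+1 ft.
    have oldR s z : (t < s)%N ->
        in_residual ob x i' y' fl' s z <-> in_residual ob x i y fl s z.
      move=> ts; split=> -[zS H]; split=> // k kd; have := H k kd;
        by rewrite /i' /y' /fl' !update_other; try lia.
    have oldC s z : (t < s)%N ->
        competitor ob x i' y' fl' s z <-> competitor ob x i y fl s z.
      by move=> ts; split=> -[H1 H2]; split=> //; apply/(oldR _ _ ts).
    have newR z : in_residual ob x i' y' fl' t z <-> in_residual ob x i y fl t.+1 z /\
        z it = x it /\ (ft -> ob t.+1 z < ob t.+1 yt).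
      split.
        move=> [zS H]; split.
          by apply/(oldR _ _ (leqnn _)); split=> // k kd; apply: H; lia.
        by have := H t; rewrite leqnn td /i' /y' /fl' !update_same; apply.
      move=> [/(oldR _ _ (leqnn _)) [zS H] H']; split=> // k /andP[].
      rewrite leq_eqVlt => /predU1P[<- _|tk kd]; last by apply: H; rewrite tk.
      by rewrite /i' /y' /fl' !update_same.
    exists i', y', fl'; split.
    (* By the invariant [x] is at most [yt] in objective [t.+1]; as they differ at [it], the
       inequality is strict. *)
    - apply/newR; split=> //; split=> // /Et[[yR yC] ymin].
      have := inv _ yR yC; rewrite le_eqVlt => /predU1P[/inj e|//].
      have /e exy : (t.+1 <= d)%N by lia.
      by have := Ex; rewrite exy; case: (yt it).
    (* If [z] beat [x] in objective [t] too, it would be a competitor of step [t.+1], either better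
       than the minimiser [yt] or where none exists. *)
    - move=> z /newR [zR [zx zf]] zC; rewrite leNgt; apply/negP => lt.
      have zC1 : competitor ob x i y fl t.+1 z.
        split=> // r; rewrite ltnS leq_eqVlt => /predU1P[->//|]; exact: zC.
      case: (boolP ft) => [hf|/Ef/(_ z)//].
      have [_ /(_ _ zC1)] := Et hf; rewrite leNgt => /negP; apply; exact: zf.
    - move=> j k /andP[]; rewrite leq_eqVlt => /predU1P[<-|tj] tk kd.
        by rewrite /y' /i' update_same update_other; [apply: Ek; lia|lia].
      by rewrite /y' /i' !update_other; [apply: Pj; lia|lia|lia].
    - move=> k /andP[]; rewrite leq_eqVlt => /predU1P[<- _|tk kd].
        by rewrite /y' /i' !update_same.
      by rewrite /y' /i' !update_other; [apply: Pk; lia|lia|lia].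
    - move=> s /andP[]; rewrite leq_eqVlt => /predU1P[<- _|ts sd].
        rewrite /is_min /y' /fl' !update_same => /Et[H1 H2]; split.
          exact/(oldC t.+1).
        by move=> z /(oldC t.+1 z (ltnSn _)); exact: H2.
      have nst : s != t.+1 by lia.
      have -> : fl' s = fl s by rewrite /fl' update_other.
      move=> fs; have [|H1 H2] := Pm s _ fs; first by lia.
      have sd' : (t < s)%N by lia.
      have ey : y' s = y s by rewrite /y' update_other.
      rewrite /is_min ey; split; first exact/(oldC s).
      by move=> z /(oldC s z sd'); exact: H2.
  have [[z0 z0C]|noC] := pselect (exists z, competitor ob x i y fl t.+1 z).
    pose P := [pred z : binvec n | `[<competitor ob x i y fl t.+1 z>]].
    have P0 : P z0 by apply/asboolP.
    case: (@arg_minP _ _ _ z0 P (ob t.+1) P0) => yt /asboolP ytC ytmin.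
    have : yt != x.
      by apply/eqP => e; have := ytC.2 0%N isT; rewrite e ltxx.
    move=> /eqP ne.
    have [it Hit] : exists it, yt it != x it.
      apply/existsP; apply: contra_notT ne => /existsPn H; apply/ffunP => it.
      by have /negPn/eqP := H it.
    exists it, yt, true; split=> //.
    - by move: Hit; case: (yt it); case: (x it).
    - by move=> k /ytC.1.2[].
    - by move=> _; split=> // z zC; apply: ytmin; apply/asboolP.
  have [it fresh] : exists it, forall k, (t < k < d)%N -> i k != it.
    pose U := [set i (t.+1 + k)%N | k : 'I_(d - t.+1)].
    have : (#|U| < n)%N.
      by apply: leq_ltn_trans (leq_imset_card _ _) _; rewrite card_ord; lia.
    rewrite -[X in (_ < X)%N](card_ord n) -cardsT => Un.
    have /subsetPn[it _ itU] : ~~ ([set: 'I_n] \subset U).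
      by apply/negP => /subset_leq_card; rewrite leqNgt Un.
    exists it => k tkd; apply: contra itU => /eqP <-.
    have kd : (k - t.+1 < d - t.+1)%N by lia.
    by apply/imsetP; exists (Ordinal kd) => //=; congr (i _); lia.
  exists it, (finfun (fun l => if l == it then ~~ x l else x l)), false; split=> //.
  - by rewrite ffunE eqxx.
  - by move=> k kd; rewrite ffunE (negPf (fresh _ kd)).
  - by move=> _ z zC; apply: noC; exists z.
have [i [y [fl]]] := main d (leqnn _); rewrite subnn => -[Rx inv Pj Pk Pm].
exists i, (update y 0%N x), (update fl 0%N true); split; rewrite ?update_same//.
- move=> [|j] k jkd; first by rewrite update_same.
  by rewrite update_other//; apply: Pj; lia.
have oldC s z : competitor ob x i (update y 0%N x) (update fl 0%N true) s z <->
    competitor ob x i y fl s z by [].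
  move=> [|t] td.
    move=> _; rewrite /is_min update_same; split; first by [].
    by move=> z [zR _]; apply: inv.
  by rewrite update_other// => /(Pm t.+1) H; apply: H; lia.
Qed.
End Certificate.

(* In the application [D j k] is the bit of [y j] minus that of [y d] at [i k]. *)
Lemma columns_span (d : nat) (D : nat -> nat -> int) :
  (forall k, (k < d)%N -> D d k = 0) ->
  (forall k j, (j <= k < d)%N -> D j k = D 0%N k) ->
  (forall k, (k < d)%N -> `|D k.+1 k - D 0%N k| = 1) ->
  forall m (f : nat -> int), f d = 0 ->
    (forall j, (j <= d - m)%N -> f j = f 0%N) ->
  exists c : nat -> int, forall j, (j <= d)%N ->
    \sum_(k < d) c k * D j k = f j.
Proof.
(* Induction on [m], which bounds the range where [f] may vary; a constant [f] is zero because
   [f d = 0]. *)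
move=> Dd Dc D1; elim=> [|m IH] f fd fc.
  rewrite subn0 in fc.
  exists (fun _ => 0) => j jd; rewrite big1 => [|k _]; last by rewrite mul0r.
  by rewrite fc// -(fc d).
have [md|dm] := ltnP m d; last first.
  by apply: IH => // j jm; apply: fc; lia.
set r := (d - m.+1)%N in fc *.
have rd : (r < d)%N by lia.
(* Subtracting [a] times column [r] makes [f] constant on [0, r + 1]. *)
pose a := (f r.+1 - f 0%N) * (D r.+1 r - D 0%N r).
have [|j jm|c Hc] := IH (fun j => f j - a * D j r).
- by rewrite fd Dd// mulr0 subrr.
- have : (j <= r.+1)%N by lia.
  rewrite leq_eqVlt => /predU1P[->|jr].
    have := D1 r rd; rewrite /a.
    case: (ler0P (D r.+1 r - D 0%N r)) => _ e;
      have -> : D r.+1 r = D 0%N r + (D r.+1 r - D 0%N r) by ring.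
      have -> : D r.+1 r - D 0%N r = -1 by lia.
      by ring.
    rewrite e; ring.
  by rewrite fc ?(Dc r j)//; lia.
exists (fun k => c k + a *+ (k == r)) => j jd.
under eq_bigr do rewrite mulrDl.
rewrite big_split /= Hc// (bigD1 (Ordinal rd))//= eqxx mulr1n big1 => [|k kr].
  by ring.
suff /negPf -> : val k != r by rewrite mulr0n mul0r.
by apply: contra kr => /eqP e; apply/eqP/val_inj.
Qed.

Lemma certificate_ext n d (S : {set binvec n}) ob x i y fl i' fl' :
  (forall k, (k < d)%N -> i k = i' k) -> (forall t, (t <= d)%N -> fl t = fl' t) ->
  certificate d S ob x i y fl -> certificate d S ob x i' y fl'.
Proof.
move=> ei ef [y0 f0 Hj Hk Hm].
have eC t z : competitor d S ob x i y fl t z <-> competitor d S ob x i' y fl' t z.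
  split=> -[[zS H] HC]; split=> //; split=> // k kd; have [H1 H2] := H k kd.
    by rewrite -ei; [split=> // fk; apply: H2; rewrite ef//; lia|lia].
  by rewrite ei; [split=> // fk; apply: H2; rewrite -ef//; lia|lia].
split=> //.
- by rewrite -ef.
- by move=> j k jkd; rewrite -ei; [exact: Hj|lia].
- by move=> k kd; rewrite -ei; [exact: Hk|].
- move=> t td; rewrite -ef// => /(Hm _ td)[H1 H2]; split; first exact/eC.
  by move=> z /eC; apply: H2.
Qed.

(** * Counting certified solutions along shift directions *)

Definition linval n (w : 'I_n -> int) (z : binvec n) : int :=
  \sum_i w i * (z i)%:R.

Lemma linvalD n (w w' : 'I_n -> int) a z :
  linval (fun i => w i + a * w' i) z = linval w z + a * linval w' z.
Proof.
by rewrite /linval mulr_sumr -big_split /=; apply: eq_bigr => i _; rewrite mulrDl mulrA.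
Qed.

Lemma linval_diff_le n (w : 'I_n -> int) (N : nat) x u :
  (forall i, `|w i| <= N%:Z) -> `|linval w x - linval w u| <= (n * N)%:Z.
Proof.
move=> wN; rewrite /linval -sumrB; apply: le_trans (ler_norm_sum _ _ _) _.
apply: (@le_trans _ _ (\sum_(i < n) N%:Z)); last first.
  by rewrite sumr_const card_ord; lia.
apply: ler_sum => i _; have := wN i.
by case: (x i); case: (u i); rewrite /= ?mulr1 ?mulr0 ?subr0 ?sub0r ?subrr
  ?normrN ?normr0//; lia.
Qed.

Lemma inord_absz_inj (B : nat) (a b : int) :
  inord (absz (a + B%:Z)) = inord (absz (b + B%:Z)) :> 'I_(2 * B).+1 ->
  `|a| <= B%:Z -> `|b| <= B%:Z -> a = b.
Proof. by move=> /(congr1 val) /= e aB bB; move: e; rewrite !inordK; lia. Qed.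

Section Grid.
Variables (n d N : nat).

Definition coord (k : 'I_(2 * N).+1) : int := k%:Z - N%:Z.

Lemma coord_inj : injective coord.
Proof. by move=> k l /addIr [/val_inj]. Qed.

Lemma coord_le k : `|coord k| <= N%:Z.
Proof. by rewrite /coord; have := ltn_ord k; lia. Qed.

Definition int_row := {ffun 'I_n -> 'I_(2 * N).+1}.
Definition int_matrix := {ffun 'I_d.+1 -> int_row}.
Definition row_coord (w : int_row) : 'I_n -> int := fun i => coord (w i).

Lemma row_coord_inj (w w' : int_row) : row_coord w =1 row_coord w' -> w = w'.
Proof. by move=> e; apply/ffunP => i; apply: coord_inj; apply: e. Qed.

Variables (S : {set binvec n}) (L : binvec n -> int).
Hypothesis Linj : injective L.

(** There are [d.+1] linear rows here, so the procedure runs with [d.+1] for its [d], and index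
    [d.+1] is the arbitrary objective, represented by an injective integer ranking [L]. *)
Definition objectives (W : int_matrix) (r : nat) (z : binvec n) : int :=
  if (r < d.+1)%N then linval (row_coord (W (inord r))) z else L z.

(** The margin [n] absorbs the rounding: each of the [n] coefficients moves a difference of scaled
    objectives by at most 1. It also makes the linear objectives injective. *)
Definition separated (W : int_matrix) : bool :=
  [forall r, forall z, forall z', (z != z') ==>
     (n%:Z < `|linval (row_coord (W r)) z - linval (row_coord (W r)) z'|)].

(** The part of Pareto optimality that survives rounding: no solution beats [x] strictly in every
    objective. *)
Definition candidate (W : int_matrix) (x : binvec n) : bool :=
  (x \in S) && [forall z in S,
    [forall r, linval (row_coord (W r)) z < linval (row_coord (W r)) x] ==> (L x <= L z)].

(* Entry [(j, k)] is the bit of the witness [y j] at the index [i k]. *)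
Definition pattern := {ffun 'I_d.+2 * 'I_d.+1 -> bool}.
Definition cert_type : finType :=
  ({ffun 'I_d.+1 -> 'I_n} * pattern * {ffun 'I_d.+2 -> bool})%type.

Definition certified (c : cert_type) (W : int_matrix) (x : binvec n) : Prop :=
  separated W /\ exists y,
    certificate d.+1 S (objectives W) x (fun k => c.1.1 (inord k)) y
      (fun t => c.2 (inord t))
    /\ forall j k, (j <= d.+1)%N -> (k < d.+1)%N ->
      y j (c.1.1 (inord k)) = c.1.2 (inord j, inord k).

Lemma objectives_inj W t : separated W -> injective (objectives W t).
Proof.
move=> sW z z'; rewrite /objectives; case: ifP => _; last exact: Linj.
move=> e; apply: contraTeq isT => ne.
have := forallP (forallP (forallP sW (inord t)) z) z'.
by rewrite ne e subrr normr0.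
Qed.

Lemma certified_exists W x : (d < n)%N -> separated W -> candidate W x ->
  exists c : cert_type, certified c W x.
Proof.
move=> dn sW /andP[xS /forall_inP cx].
have n0 : (0 < n)%N by lia.
have [|i [y [fl cert]]] := @certificate_exists n d.+1 S (objectives W) x
  n0 dn xS (fun t _ => @objectives_inj W t sW).
  move=> z zS H; rewrite /objectives ltnn; apply: (implyP (cx z zS)).
  by apply/forallP => r; have := H r (ltn_ord r); rewrite /objectives ltn_ord inord_val.
pose c : cert_type := ([ffun k : 'I_d.+1 => i k],
  [ffun jk : 'I_d.+2 * 'I_d.+1 => y jk.1 (i jk.2)], [ffun t : 'I_d.+2 => fl t]).
exists c; split=> //; exists y; split.
  apply: certificate_ext cert => [k kd|t td]; by rewrite ffunE inordK.
by move=> j k jd kd; rewrite !ffunE /= !inordK.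
Qed.

Variable c : cert_type.
Variable coef : nat -> nat -> int.
Hypothesis coefP : forall r, (r < d.+1)%N -> forall j, (j <= d.+1)%N ->
  \sum_(k < d.+1) coef r k *
    ((c.1.2 (inord j, k))%:R - (c.1.2 (ord_max, k))%:R) = (j <= r)%N%:R.

(** The direction along which row [r] is moved, supported on the certificate indices; by [coefP] it
    separates the witnesses [y j] with [j <= r] from those with [j > r]. *)
Definition direction (r : 'I_d.+1) (i : 'I_n) : int :=
  \sum_(k < d.+1) coef r k *+ (c.1.1 k == i).

Lemma linval_direction r z :
  linval (direction r) z = \sum_(k < d.+1) coef r k * (z (c.1.1 k))%:R.
Proof.
rewrite /linval /direction; under eq_bigr do rewrite mulr_suml.
rewrite exchange_big /=; apply: eq_bigr => k _.
rewrite (bigD1 (c.1.1 k))//= eqxx mulr1n big1 ?addr0// => i /negPf ne.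
by rewrite eq_sym ne mulr0n mul0r.
Qed.

Lemma linval_direction_pattern (r : 'I_d.+1) j (z : binvec n) : (j <= d.+1)%N ->
  (forall k, (k < d.+1)%N -> z (c.1.1 (inord k)) = c.1.2 (inord j, inord k)) ->
  linval (direction r) z =
    (j <= r)%N%:R + \sum_(k < d.+1) coef r k * (c.1.2 (ord_max, k))%:R.
Proof.
move=> jd zA; rewrite -(coefP (ltn_ord r) jd) -big_split /= linval_direction.
apply: eq_bigr => k _; rewrite -mulrDr subrK.
by have := zA k (ltn_ord k); rewrite inord_val => ->.
Qed.

(* [base] depends on the certificate only and agrees with the witness [y d] at all
   certificate indices, so that subtracting it removes the constant in
   [linval_direction_pattern]. *)
Definition base : binvec n :=
  [ffun i => [exists k, (c.1.1 k == i) && c.1.2 (ord_max, k)]].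

(** The existence of a certified solution ensures that repeated indices carry equal bits, so that
    [base] has the bits of [y d.+1]. *)
Lemma linval_direction_base r W x : certified c W x ->
  linval (direction r) base = \sum_(k < d.+1) coef r k * (c.1.2 (ord_max, k))%:R.
Proof.
move=> [_ [y [_ yA]]]; rewrite linval_direction; apply: eq_bigr => k _.
congr (_ * _%:R); congr nat_of_bool; rewrite ffunE.
have A l : c.1.2 (ord_max, l) = y d.+1 (c.1.1 l).
  have := yA d.+1 l (leqnn _) (ltn_ord l); rewrite !inord_val => ->.
  by congr (c.1.2 (_, _)); apply/val_inj; rewrite /= inordK.
apply/existsP/idP => [[l /andP[/eqP e]]|Ak]; last by exists k; rewrite eqxx.
by rewrite !A e.
Qed.

Lemma linval_direction_certified r W x : certified c W x ->
  linval (direction r) x - linval (direction r) base = 1.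
Proof.
move=> cx; rewrite (linval_direction_base _ cx) (@linval_direction_pattern r 0%N)// ?addrK//.
by case: cx => _ [y [[<- _ _ _ _] yA]] k kd; rewrite yA.
Qed.

(** Moving row [r] changes its objective equally for all [y j] with [j <= r], and relative to [base]
    not at all for [j > r]. As the values of [x1] and [x2] relative to [base] agree, both runs
    compare alike and [reconstruction] applies. Each unit of shift raises the value of [x1] relative
    to [base] by 1, so no shift remains. *)
Lemma certified_inj W1 W2 x1 x2 (a : 'I_d.+1 -> int) :
  certified c W1 x1 -> certified c W2 x2 ->
  (forall r i, row_coord (W2 r) i = row_coord (W1 r) i + a r * direction r i) ->
  (forall r, linval (row_coord (W1 r)) x1 - linval (row_coord (W1 r)) base =
             linval (row_coord (W2 r)) x2 - linval (row_coord (W2 r)) base) ->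
  (x1 = x2) /\ (forall r, a r = 0).
Proof.
move=> c1 c2 W12 b12.
have lin12 r z : linval (row_coord (W2 r)) z =
    linval (row_coord (W1 r)) z + a r * linval (direction r) z.
  by rewrite -linvalD; apply: eq_bigr => i _; rewrite W12.
have ex : x1 = x2.
  have [s1 [y1 [C1 A1]]] := c1.
  have [s2 [y2 [C2 A2]]] := c2.
  apply: (@reconstruction n d.+1 S (fun j k => c.1.2 (inord j, inord k))
    _ _ (objectives W1) (objectives W2) x1 x2 y1 y2 _ C1 C2 A1 A2) => [t _||].
  - exact: objectives_inj.
  - move=> r j j' z z' rd jr j'r zA zA'; rewrite /objectives; case: ifP => // rd'.
    have rE : (inord r : 'I_d.+1) = r :> nat by rewrite inordK.
    rewrite !lin12 (@linval_direction_pattern _ j z)//; last lia.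
    rewrite (@linval_direction_pattern _ j' z')//; last lia.
    by rewrite rE jr j'r ltrD2r.
  - move=> r j z /andP[rj jd] zA; have rd : (r < d.+1)%N by lia.
    rewrite /objectives rd; set r' := inord r.
    have rE : r' = r :> nat by rewrite inordK.
    have := b12 r'; rewrite !lin12 (@linval_direction_pattern _ j z)//.
    rewrite (linval_direction_base _ c1) rE leqNgt rj /= mulr0n add0r.
    by move: (a r' * _) (a r' * _) => A B b; apply/idP/idP; lia.
split=> // r; have := b12 r; rewrite !lin12 -ex.
have := linval_direction_certified r c1.
set u := linval _ _; set v := linval (direction r) base.
move=> e b.
have : a r * (u - v) = 0 by rewrite mulrBr; lia.
by rewrite e mulr1.
Qed.

Variable H : nat.
(** A relation rather than a map, since the shifted row may leave the grid. *)
Definition shifted (w : int_row) (v : 'I_n -> int) (s : 'I_H) (w' : int_row) : bool :=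
  [forall i, row_coord w' i == row_coord w i + s%:Z * v i].

(** The [d.+1] values of a solution relative to [base] lie between [- n N] and [n N]. By
    [certified_inj] they determine the triple of matrix, shift and solution. *)
Lemma certified_count (W' : int_matrix) :
  (\sum_(W : int_matrix) \sum_(s : {ffun 'I_d.+1 -> 'I_H})
     [forall r, shifted (W r) (direction r) (s r) (W' r)] *
     #|[pred x | `[<certified c W x>] ]| <= (2 * n * N).+1 ^ d.+1)%N.
Proof.
rewrite pair_big /=.
pose P (t : int_matrix * {ffun 'I_d.+1 -> 'I_H} * binvec n) :=
  [forall r, shifted (t.1.1 r) (direction r) (t.1.2 r) (W' r)] &&
  `[<certified c t.1.1 t.2>].
have -> : (\sum_(p : int_matrix * {ffun 'I_d.+1 -> 'I_H})
     [forall r, shifted (p.1 r) (direction r) (p.2 r) (W' r)] *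
     #|[pred x | `[<certified c p.1 x>] ]| = #|[set t | P t]|)%N.
  rewrite cardsE -sum1_card [RHS]big_mkcond /=.
  transitivity (\sum_(p : int_matrix * {ffun 'I_d.+1 -> 'I_H}) \sum_(x : binvec n)
      (if P (p, x) then 1 else 0))%N; last first.
    by rewrite pair_big; apply: eq_bigr => -[].
  apply: eq_bigr => p _; rewrite -sum1_card big_distrr /= [LHS]big_mkcond /=.
  apply: eq_bigr => x _; rewrite /P /= unfold_in /=.
  by case: [forall r, _]; case: `[< _ >].
pose b (t : int_matrix * {ffun 'I_d.+1 -> 'I_H} * binvec n) :
    {ffun 'I_d.+1 -> 'I_(2 * n * N).+1} :=
  [ffun r => inord (absz (linval (row_coord (t.1.1 r)) t.2 -
     linval (row_coord (t.1.1 r)) base + (n * N)%:Z))].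
have cb : #|{ffun 'I_d.+1 -> 'I_(2 * n * N).+1}| = ((2 * n * N).+1 ^ d.+1)%N.
  by rewrite card_ffun !card_ord.
rewrite -cb -(@card_in_imset _ _ b) ?max_card// => -[[W1 s1] x1] [[W2 s2] x2].
rewrite !inE /P /= => /andP[/forallP h1 /asboolP c1] /andP[/forallP h2 /asboolP c2] eb.
have [|r|ex ea] := @certified_inj W1 W2 x1 x2 (fun r => (s1 r)%:Z - (s2 r)%:Z) c1 c2.
- move=> r i; have /eqP e1 := forallP (h1 r) i; have /eqP e2 := forallP (h2 r) i.
  by rewrite mulrBl addrA; apply/eqP; rewrite eq_sym subr_eq -e1 e2.
- have := congr1 (fun f : {ffun _ -> _} => f r) eb; rewrite !ffunE /= -mulnA.
  by move/inord_absz_inj; apply; apply: linval_diff_le => i; apply: coord_le.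
have es : s1 = s2 by apply/ffunP => r; apply: val_inj; have /= := ea r; lia.
congr (_, _, _) => //; apply/ffunP => r; apply: row_coord_inj => i.
have /eqP e1 := forallP (h1 r) i; have /eqP e2 := forallP (h2 r) i.
by move: e1; rewrite e2 es => /addIr ->.
Qed.

End Grid.

(** * Product weights and total variation *)

Section Weights.
Variable R : realFieldType.

(** A charging argument: [q w] is paid for by the weights [D w'] of the points related to [w], and
    each [w'] is charged with total multiplicity at most [B]. *)
Lemma transport_le (T Sh : finType) (rho : T -> Sh -> T -> bool) (q D : T -> R)
    (E : T -> nat) (B : nat) :
  (forall w, 0 <= D w) ->
  (forall w, q w <= \sum_s \sum_w' (rho w s w')%:R * D w') ->
  (forall w', \sum_w \sum_s rho w s w' * E w <= B)%N ->
  \sum_w q w * (E w)%:R <= B%:R * \sum_w D w.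
Proof.
move=> D0 qD EB.
apply: (@le_trans _ _ (\sum_w (\sum_s \sum_w' (rho w s w')%:R * D w') * (E w)%:R)).
  by apply: ler_sum => w _; apply: ler_wpM2r.
have -> : \sum_w (\sum_s \sum_w' (rho w s w')%:R * D w') * (E w)%:R =
    \sum_w' (\sum_w \sum_s rho w s w' * E w)%N%:R * D w'.
  under [RHS]eq_bigr => w' _.
    rewrite natr_sum mulr_suml.
    under eq_bigr do rewrite natr_sum mulr_suml.
    over.
  rewrite [RHS]exchange_big; apply: eq_bigr => w _.
  rewrite exchange_big /= mulr_suml; apply: eq_bigr => w' _.
  by rewrite mulr_suml; apply: eq_bigr => s _; rewrite natrM; ring.
rewrite mulr_sumr; apply: ler_sum => w' _; apply: ler_wpM2r => //.
by rewrite ler_nat.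
Qed.

Lemma prod_bool (I : finType) (b : I -> bool) :
  \prod_i (b i)%:R = [forall i, b i]%:R :> R.
Proof.
case: forallP => [H|H]; first by rewrite big1// => i _; rewrite H.
have [i /negPf bi] : exists i, ~~ b i.
  by apply/existsP; rewrite -negb_forall; apply/forallP.
by rewrite (bigD1 i)//= bi mul0r.
Qed.

Lemma transport_prod_le (I T Sh : finType) (rho : I -> T -> Sh -> T -> bool)
    (q D : I -> T -> R) (E : {ffun I -> T} -> nat) (B : nat) :
  (forall i w, 0 <= q i w) -> (forall i w, 0 <= D i w) ->
  (forall i w, q i w <= \sum_s \sum_w' (rho i w s w')%:R * D i w') ->
  (forall w' : {ffun I -> T}, \sum_(w : {ffun I -> T}) \sum_(s : {ffun I -> Sh})
     [forall i, rho i (w i) (s i) (w' i)] * E w <= B)%N ->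
  \sum_(w : {ffun I -> T}) (\prod_i q i (w i)) * (E w)%:R <=
    B%:R * \prod_i \sum_w D i w.
Proof.
move=> q0 D0 qD EB; rewrite bigA_distr_bigA /=.
apply: (transport_le (rho := fun (w : {ffun I -> T}) (s : {ffun I -> Sh})
   (w' : {ffun I -> T}) => [forall i, rho i (w i) (s i) (w' i)])) EB.
  by move=> w; apply: prodr_ge0.
move=> w.
apply: (@le_trans _ _ (\prod_i \sum_s \sum_w' (rho i (w i) s w')%:R * D i w')).
  by apply: ler_prod => i _; rewrite q0 qD.
rewrite bigA_distr_bigA /=; apply: ler_sum => s _.
rewrite bigA_distr_bigA /=; apply: ler_sum => w' _.
by rewrite big_split /= prod_bool.
Qed.

(** Telescope through the hybrid products whose factors come from [b] before position [i] and from
    [a] after it. *)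
Lemma ler_dist_prod (n : nat) (a b : 'I_n -> R) :
  (forall i, 0 <= a i) -> (forall i, 0 <= b i) ->
  `|\prod_i a i - \prod_i b i| <=
  \sum_(i < n) \prod_(j < n)
    (if (j < i)%N then b j else if j == i then `|a i - b i| else a j).
Proof.
elim: n a b => [|n IH] a b a0 b0; first by rewrite !big_ord0 subrr normr0.
rewrite big_ord_recr [X in _ - X]big_ord_recr big_ord_recr /=.
set A := \prod_(i < n) a _; set A' := \prod_(i < n) b _.
have -> : A * a ord_max - A' * b ord_max =
   (A - A') * a ord_max + A' * (a ord_max - b ord_max) by ring.
apply: le_trans (ler_normD _ _) _; apply: lerD.
  rewrite normrM (ger0_norm (a0 _)).
  apply: le_trans (ler_wpM2r (a0 _) (IH _ _ _ _)) _ => //.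
  rewrite mulr_suml; apply: ler_sum => i _; rewrite big_ord_recr /=.
  have -> : (n < i)%N = false by have := ltn_ord i; lia.
  have -> : (ord_max == widen_ord (leqnSn n) i) = false.
    by apply/negbTE/eqP => /(congr1 val) /=; have := ltn_ord i; lia.
  by [].
rewrite big_ord_recr /= ltnn eqxx normrM ger0_norm ?prodr_ge0//.
rewrite /A'; under [X in _ <= X * _]eq_bigr => j _ do rewrite ltn_ord.
by [].
Qed.

(* Replace the factors one at a time. *)
Lemma sum_dist_prod_le (n : nat) (K : finType) (a b : 'I_n -> K -> R) (e : 'I_n -> R) :
  (forall i k, 0 <= a i k) -> (forall i k, 0 <= b i k) ->
  (forall i, \sum_k a i k <= 1) -> (forall i, \sum_k b i k <= 1) ->
  (forall i, \sum_k `|a i k - b i k| <= e i) ->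
  \sum_(w : {ffun 'I_n -> K}) `|\prod_i a i (w i) - \prod_i b i (w i)| <= \sum_i e i.
Proof.
move=> a0 b0 a1 b1 abe.
pose F (i j : 'I_n) k :=
  if (j < i)%N then b j k else if j == i then `|a i k - b i k| else a j k.
apply: (@le_trans _ _ (\sum_(w : {ffun 'I_n -> K}) \sum_i \prod_j F i j (w j))).
  apply: ler_sum => w _.
  apply: le_trans (ler_dist_prod (fun i => a0 i (w i)) (fun i => b0 i (w i))) _.
  rewrite le_eqVlt; apply/orP; left; apply/eqP/eq_bigr => i _; apply: eq_bigr => j _.
  by rewrite /F; case: ifP => // _; case: eqP => // ->.
rewrite exchange_big /=; apply: ler_sum => i _.
rewrite -(bigA_distr_bigA (F i)) /=.
have F0 j k : 0 <= F i j k by rewrite /F; case: ifP => // _; case: ifP.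
rewrite (bigD1 i)//= -[leRHS]mulr1; apply: ler_pM.
- exact: sumr_ge0.
- by apply: prodr_ge0 => j _; apply: sumr_ge0.
- apply: le_trans (abe i); apply: ler_sum => k _.
  by rewrite /F ltnn eqxx.
- apply: prodr_ile1 => j /negPf ji; apply/andP; split; first exact: sumr_ge0.
  have -> : \sum_k F i j k = if (j < i)%N then \sum_k b j k else \sum_k a j k.
    by case: ifP => jlt; apply: eq_bigr => k _; rewrite /F jlt ?ji.
  by case: ifP.
Qed.

Section Row.
Variables (n N : nat) (p : 'I_n -> int -> R) (tau : R).
Hypothesis p_ge0 : forall i k, 0 <= p i k.
Hypothesis p_supp : forall i (k : int), N%:Z < `|k| -> p i k = 0.
Hypothesis p_mass : forall i (a : int) (l : nat), \sum_(k < l) p i (a + k%:Z) <= 1.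
Hypothesis p_var : forall i (a : int) (l : nat),
  \sum_(k < l) `|p i (a + k%:Z) - p i (a + k%:Z + 1)| <= tau.

Definition rowmass (z : 'I_n -> int) : R := \prod_i p i (z i).

Lemma rowmass_ge0 z : 0 <= rowmass z.
Proof. exact: prodr_ge0. Qed.

Lemma tau_ge0 : (0 < n)%N -> 0 <= tau.
Proof. by move=> n0; have := p_var (Ordinal n0) 0 0; rewrite big_ord0. Qed.

Lemma rowmass_supp z i : N%:Z < `|z i| -> rowmass z = 0.
Proof. by move=> Nz; rewrite /rowmass (bigD1 i)//= p_supp// mul0r. Qed.

(** Split the shift into unit steps; each costs at most [tau] because [p_var] holds on every
    window. *)
Lemma variation_shift i (a : int) (v l : nat) :
  \sum_(k < l) `|p i (a + k%:Z) - p i (a + k%:Z + v%:Z)| <= v%:R * tau.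
Proof.
elim: v a => [|v IH] a.
  by rewrite mul0r big1// => k _; rewrite addr0 subrr normr0.
apply: (@le_trans _ _ (\sum_(k < l) `|p i (a + k%:Z) - p i (a + k%:Z + 1)| +
   \sum_(k < l) `|p i (a + 1 + k%:Z) - p i (a + 1 + k%:Z + v%:Z)|)).
  rewrite -big_split /=; apply: ler_sum => k _.
  have -> : a + 1 + k%:Z = a + k%:Z + 1 by ring.
  have -> : a + k%:Z + v.+1%:Z = a + k%:Z + 1 + v%:Z by lia.
  exact: ler_distD.
by rewrite -natr1 mulrDl mul1r addrC lerD.
Qed.

Lemma variation_coord i (v : int) :
  \sum_(k < (2 * N).+1) `|p i (coord k) - p i (coord k + v)| <= `|v|%:~R * tau.
Proof.
case: (intP v) => [|m|m].
- by rewrite normr0 mul0r big1// => k _; rewrite addr0 subrr normr0.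
- rewrite (_ : `|m.+1%:Z|%:~R = m.+1%:R :> R); last by [].
  by under eq_bigr do rewrite [coord _]addrC; apply: variation_shift.
- rewrite (_ : `|- m.+1%:Z|%:~R = m.+1%:R :> R); last by rewrite normrN.
  (* A negative shift is the positive one on a translated window, with the two terms exchanged. *)
  rewrite (eq_bigr (fun k : 'I_(2 * N).+1 => `|p i (- N%:Z - m.+1%:Z + k%:Z) -
      p i (- N%:Z - m.+1%:Z + k%:Z + m.+1%:Z)|)); first exact: variation_shift.
  by move=> k _; rewrite distrC /coord; congr (`|p i _ - p i _|); lia.
Qed.

(* Along a line of direction [v], every value of [rowmass] is at most the sum of
   all later decrements. *)
Definition mass_drop (v : 'I_n -> int) (w : int_row n N) : R :=
  Num.max 0 (rowmass (row_coord w) - rowmass (fun i => row_coord w i + v i)).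

Lemma mass_drop_ge0 v w : 0 <= mass_drop v w.
Proof. by rewrite le_max lexx. Qed.

(** A drop is at most the distance between two product masses, one with translated factors; the
    variations of the factors add up. *)
Lemma sum_mass_drop v : \sum_w mass_drop v w <= \sum_i `|v i|%:~R * tau.
Proof.
apply: le_trans (sum_dist_prod_le (K := 'I_(2 * N).+1) (a := fun i k => p i (coord k))
    (b := fun i k => p i (coord k + v i)) _ _ _ _ _) => //.
- apply: ler_sum => w _; rewrite /mass_drop ge_max normr_ge0 /= ler_norm//.
- move=> i; apply: le_trans (p_mass i (- N%:Z) (2 * N).+1).
  by apply: ler_sum => k _; rewrite [coord _]addrC.
- move=> i; apply: le_trans (p_mass i (- N%:Z + v i) (2 * N).+1).
  by apply: ler_sum => k _;
    rewrite /coord addrC [_ + v i]addrC addrA addrAC [v i + _]addrC.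
- by move=> i; apply: variation_coord.
Qed.

(** Telescope along [w + s v]: after [2 N + 1] steps a coordinate with [v i != 0] has left the grid
    and the mass is zero. Off-grid points contribute nothing positive, grid points at most their
    [mass_drop]. *)
Lemma rowmass_transport (v : 'I_n -> int) (w : int_row n N) : (exists i, v i != 0) ->
  rowmass (row_coord w) <=
  \sum_(s < (2 * N).+1) \sum_w' (shifted w v s w')%:R * mass_drop v w'.
Proof.
move=> [i0 vi0].
pose z (s : nat) i := row_coord w i + s%:Z * v i.
have z0 : row_coord w =1 z 0%N by move=> i; rewrite /z mul0r addr0.
have ext z1 z2 : z1 =1 z2 -> rowmass z1 = rowmass z2.
  by move=> e; apply: eq_bigr => i _; rewrite e.
have -> : rowmass (row_coord w) =
    \sum_(s < (2 * N).+1) (rowmass (z s) - rowmass (z s.+1)).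
  rewrite (ext _ _ z0) -(big_mkord predT (fun s => rowmass (z s) - rowmass (z s.+1))).
  under eq_bigr do rewrite -opprB.
  rewrite sumrN telescope_sumr// (@rowmass_supp (z (2 * N).+1) i0) ?sub0r ?opprK//.
  have := coord_le (w i0); rewrite /z /row_coord; nia.
apply: ler_sum => s _.
have [inb|/existsP[i Ni]] := boolP [forall i, `|z s i| <= N%:Z].
  pose w' : int_row n N := [ffun i => inord (absz (z s i + N%:Z))].
  have zw' : row_coord w' =1 z s.
    move=> i; rewrite /row_coord ffunE /coord inordK; have := forallP inb i; lia.
  rewrite (bigD1 w')//= (_ : shifted _ _ _ _); last first.
    by apply/forallP => i; rewrite zw'.
  rewrite mul1r; apply: ler_wpDr.
    by apply: sumr_ge0 => ? _; rewrite mulr_ge0 ?mass_drop_ge0.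
  rewrite /mass_drop le_max (ext _ _ zw').
  rewrite (ext (z s.+1) (fun i => row_coord w' i + v i)) ?lexx ?orbT// => i.
  by rewrite zw' /z intS mulrDl mul1r addrCA addrC.
rewrite (@rowmass_supp (z s) i); last by rewrite ltNge.
rewrite sub0r; apply: (@le_trans _ _ 0); first by rewrite oppr_le0 rowmass_ge0.
by apply: sumr_ge0 => ? _; rewrite mulr_ge0 ?mass_drop_ge0.
Qed.

End Row.
End Weights.

(** * The discrete bound *)

Lemma card_certified_cover n d N (S : {set binvec n}) L : injective L -> (d < n)%N ->
  forall W : int_matrix n d N,
  (separated W * #|[pred x | candidate S L W x]| <=
   \sum_(c : cert_type n d) #|[pred x | `[<certified S L c W x>] ]|)%N.
Proof.
move=> Linj dn W; case: (boolP (separated W)) => [sW|_]; last by rewrite mul0n.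
rewrite mul1n; under eq_bigr do rewrite -sum1_card big_mkcond.
rewrite exchange_big /= -sum1_card big_mkcond; apply: leq_sum => x _.
case: ifP => // cx; have [c Hc] := certified_exists Linj dn sW cx.
by rewrite (bigD1 c)//= ifT// unfold_in; apply/asboolP.
Qed.

(** The bit conditions of [certificate], with row 0 standing for [x], stated on the pattern alone so
    that coefficients can be chosen from it. *)
Definition valid_pattern d (a : pattern d) :=
  [forall k : 'I_d.+1, (a (inord k.+1, k) == ~~ a (ord0, k)) &&
     [forall j : 'I_d.+2, (j <= k)%N ==> (a (j, k) == a (ord0, k))]].

Lemma certified_valid n d N (S : {set binvec n}) L c (W : int_matrix n d N) x :
  certified S L c W x -> valid_pattern c.1.2.
Proof.
move=> [_ [y [[y0 _ Hj Hk _] yA]]]; apply/forallP => k.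
have A j : c.1.2 (j, k) = y j (c.1.1 k).
  have := yA j k (ltn_ord j : j <= d.+1)%N (ltn_ord k); rewrite !inord_val => <-.
  by [].
have kd := ltn_ord k.
have := Hk k kd; have := Hj ^~ k; rewrite inord_val => Hj' Hk'.
rewrite !A inordK ?Hk'; last lia.
rewrite y0 eqxx /=; apply/forallP => j; apply/implyP => jk.
by rewrite A Hj'// jk kd.
Qed.

(** Apply [columns_span] to the bits minus those of the last row, with the step function [j <= r] as
    target. The coefficients depend on the pattern only, and for given [d] there are finitely many
    patterns; this keeps [n] out of the constant. *)
Lemma coefficients_exist d : exists coef : pattern d -> nat -> nat -> int,
  forall a, valid_pattern a -> forall r, (r < d.+1)%N -> forall j, (j <= d.+1)%N ->
  \sum_(k < d.+1) coef a r k * ((a (inord j, k))%:R - (a (ord_max, k))%:R) =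
  (j <= r)%N%:R.
Proof.
pose P (a : pattern d) (coef : nat -> nat -> int) :=
  valid_pattern a -> forall r, (r < d.+1)%N -> forall j, (j <= d.+1)%N ->
  \sum_(k < d.+1) coef r k * ((a (inord j, k))%:R - (a (ord_max, k))%:R) =
  (j <= r)%N%:R.
suff /choice[coef ?] : forall a, exists coef, P a coef by exists coef.
move=> a; rewrite /P; case: (boolP (valid_pattern a)) => [va|_]; last first.
  by exists (fun _ _ => 0).
pose D j k : int := (a (inord j, inord k))%:R - (a (ord_max, inord k))%:R.
have val0 j k : (j <= k < d.+1)%N -> a (inord j, inord k) = a (ord0, inord k).
  move=> /andP[jk kd]; have /andP[_ /forallP/(_ (inord j))] := forallP va (inord k).
  by rewrite !inordK ?jk; [move=> /eqP|lia..].
have val1 k : (k < d.+1)%N -> a (inord k.+1, inord k) = ~~ a (ord0, inord k).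
  by move=> kd; have /andP[/eqP] := forallP va (inord k); rewrite inordK.
have [|coef Hcoef] := @choice nat (nat -> int)
    (fun r c => (r < d.+1)%N -> forall j, (j <= d.+1)%N ->
       \sum_(k < d.+1) c k * D j k = (j <= r)%N%:R).
  move=> r; case: (ltnP r d.+1) => rd; last by exists (fun _ => 0).
  have [|||||c Hc] := @columns_span d.+1 D _ _ _ d.+1 (fun j => (j <= r)%N%:R).
  - move=> k kd; rewrite /D (_ : inord d.+1 = ord_max) ?subrr//.
    by apply: val_inj; rewrite /= inordK.
  - by move=> k j jk; rewrite /D !val0//; lia.
  - move=> k kd; rewrite /D val1// (val0 0%N)//.
    by case: (a (ord0, _)); case: (a (ord_max, _)).
  - by rewrite leqNgt rd.
  - by move=> j; rewrite subnn leqn0 => /eqP->.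
  - by exists c.
exists coef => _ r rd j jd; rewrite -Hcoef//; apply: eq_bigr => k _.
by rewrite /D inord_val.
Qed.

Section Discrete.
Variables (R : realFieldType) (n d N : nat) (p : 'I_d.+1 -> 'I_n -> int -> R) (tau : R).
Hypothesis n_gt0 : (0 < n)%N.
Hypothesis p_ge0 : forall r i k, 0 <= p r i k.
Hypothesis p_supp : forall r i (k : int), N%:Z < `|k| -> p r i k = 0.
Hypothesis p_mass : forall r i (a : int) (l : nat), \sum_(k < l) p r i (a + k%:Z) <= 1.
Hypothesis p_var : forall r i (a : int) (l : nat),
  \sum_(k < l) `|p r i (a + k%:Z) - p r i (a + k%:Z + 1)| <= tau.

Definition matmass (W : int_matrix n d N) : R := \prod_r rowmass (p r) (row_coord (W r)).

Lemma matmass_ge0 W : 0 <= matmass W.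
Proof. by apply: prodr_ge0 => r _; apply: rowmass_ge0. Qed.

Lemma sum_rowmass_le1 r : \sum_(w : int_row n N) rowmass (p r) (row_coord w) <= 1.
Proof.
rewrite /rowmass /row_coord -(bigA_distr_bigA (fun i k => p r i (coord k))) /=.
apply: prodr_ile1 => i _; rewrite sumr_ge0//=.
apply: le_trans (p_mass r i (- N%:Z) (2 * N).+1).
by apply: ler_sum => k _; rewrite [coord _]addrC.
Qed.

(** The other rows sum to at most 1. *)
Lemma sum_matmass_row (r : 'I_d.+1) (h : int_row n N -> R) : (forall w, 0 <= h w) ->
  \sum_(W : int_matrix n d N) matmass W * h (W r) <=
  \sum_w rowmass (p r) (row_coord w) * h w.
Proof.
move=> h0.
pose F r' w := rowmass (p r') (row_coord w) * (if r' == r then h w else 1).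
have F0 r' w : 0 <= F r' w.
  by rewrite mulr_ge0 ?rowmass_ge0//; case: ifP.
rewrite (eq_bigr (fun W : int_matrix n d N => \prod_r' F r' (W r'))); last first.
  move=> W _; rewrite /F big_split /=; congr (_ * _).
  rewrite (bigD1 r)//= eqxx big1 ?mulr1// => r' /negPf ne; by rewrite ne.
rewrite -(bigA_distr_bigA F) (bigD1 r)//= -[leRHS]mulr1; apply: ler_pM.
- exact: sumr_ge0.
- by apply: prodr_ge0 => r' _; apply: sumr_ge0.
- by apply: ler_sum => w _; rewrite /F eqxx.
- apply: prodr_ile1 => r' /negPf ne; rewrite sumr_ge0//=.
  apply: le_trans (sum_rowmass_le1 r'); apply: ler_sum => w _.
  by rewrite /F ne mulr1.
Qed.

(** Transport along the unit vector at an index where [z] and [z'] differ: each step changes the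
    difference of their values by one, so a line carries at most [2 n + 1] close positions. *)
Lemma close_mass r z z' : z != z' ->
  \sum_(w : int_row n N) rowmass (p r) (row_coord w) *
     (`|linval (row_coord w) z - linval (row_coord w) z'| <= n%:Z)%R%:R <=
  (2 * n).+1%:R * tau.
Proof.
move=> ne.
have [i zi] : exists i, z i != z' i.
  apply/existsP; apply: contraNT ne => /existsPn H; apply/eqP/ffunP => i.
  by have /negPn/eqP := H i.
pose v j : int := (j == i)%:R.
have linv y : linval v y = (y i)%:R.
  rewrite /linval (bigD1 i)//= /v eqxx mul1r big1 ?addr0// => j /negPf ->.
  by rewrite mul0r.
have drop_le : \sum_(w : int_row n N) mass_drop (p r) v w <= tau.
  apply: le_trans (sum_mass_drop N (p_ge0 r) (p_mass r) (p_var r) v) _.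
  rewrite (bigD1 i)//= /v eqxx normr1 mul1r big1 ?addr0// => j /negPf ->.
  by rewrite normr0 mul0r.
apply: (@le_trans _ _ ((2 * n).+1%:R *
  \sum_(w : int_row n N) mass_drop (p r) v w)); last first.
  by apply: ler_wpM2l.
apply: (transport_le (rho := fun w (s : 'I_(2 * N).+1) w' => shifted w v s w')).
- by move=> w; apply: mass_drop_ge0.
- move=> w; apply: (rowmass_transport (p_ge0 r) (p_supp r)).
  by exists i; rewrite /v eqxx.
move=> w'; rewrite pair_big /=.
pose P (t : int_row n N * 'I_(2 * N).+1) := shifted t.1 v t.2 w' &&
   (`|linval (row_coord t.1) z - linval (row_coord t.1) z'| <= n%:Z).
rewrite (eq_bigr (fun t => if P t then 1 else 0)%N); last first.
  by move=> t _; rewrite /P mulnb; case: ifP.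
rewrite -big_mkcond sum1_card -cardsE.
pose b (t : int_row n N * 'I_(2 * N).+1) : 'I_(2 * n).+1 :=
  inord (absz (linval (row_coord t.1) z - linval (row_coord t.1) z' + n%:Z)).
rewrite -[leqRHS]card_ord -(@card_in_imset _ _ b) ?max_card// => -[w1 s1] [w2 s2].
rewrite !inE /P /= => /andP[/forallP h1 b1] /andP[/forallP h2 b2].
move=> /inord_absz_inj -/(_ b1 b2) e.
have sh y : linval (row_coord w1) y + s1%:Z * linval v y =
    linval (row_coord w2) y + s2%:Z * linval v y.
  by rewrite -!linvalD; apply: eq_bigr => j _; rewrite -(eqP (h1 j)) (eqP (h2 j)).
have es : s1 = s2.
  apply: val_inj; have := sh z; have := sh z'; rewrite !linv.
  move: zi e; case: (z i); case: (z' i) => //= _; lia.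
congr (_, _) => //; apply: row_coord_inj => j.
by have /eqP := h1 j; rewrite (eqP (h2 j)) es => /addIr.
Qed.

(** Union bound over the rows and the at most [4 ^ n] ordered pairs of vectors. *)
Lemma not_separated_mass :
  \sum_(W : int_matrix n d N) matmass W * (~~ separated W)%:R <=
  d.+1%:R * 4 ^+ n * (2 * n).+1%:R * tau.
Proof.
pose cl (z z' : binvec n) (w : int_row n N) : R :=
  (`|linval (row_coord w) z - linval (row_coord w) z'| <= n%:Z)%R%:R.
apply: (@le_trans _ _ (\sum_(W : int_matrix n d N) \sum_r \sum_z \sum_(z' | z != z')
   matmass W * cl z z' (W r))).
  apply: ler_sum => W _; case: (boolP (separated W)) => /=.
    by rewrite mulr0 => _; do 3 (apply: sumr_ge0 => ? _); rewrite mulr_ge0 ?matmass_ge0.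
  move=> /forallPn[r /forallPn[z /forallPn[z']]].
  rewrite negb_imply -leNgt => /andP[zz' h].
  rewrite (bigD1 r)//= (bigD1 z)//= (bigD1 z')//= /cl h -!addrA.
  rewrite lerDl !addr_ge0//; do ?[apply: sumr_ge0 => ? _];
    by rewrite mulr_ge0 ?matmass_ge0.
rewrite exchange_big /=.
have tau0 := tau_ge0 (p_var ord0) n_gt0.
apply: (@le_trans _ _ (\sum_(r : 'I_d.+1) \sum_(z : binvec n) \sum_(z' : binvec n)
   (2 * n).+1%:R * tau)).
  apply: ler_sum => r _; rewrite exchange_big /=; apply: ler_sum => z _.
  rewrite exchange_big /=.
  apply: (@le_trans _ _ (\sum_(z' | z != z') (2 * n).+1%:R * tau)).
    apply: ler_sum => z' zz'; apply: le_trans (close_mass r zz').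
    exact: (@sum_matmass_row r (cl z z')).
  rewrite big_mkcond; apply: ler_sum => z' _; case: ifP => // _.
  by rewrite mulr_ge0.
rewrite !sumr_const !card_ffun !card_ord card_bool le_eqVlt; apply/orP; left.
rewrite -2!mulrnA -[X in X == _]mulr_natl !natrM natrX.
rewrite [X in _ * X ^+ n * _ * _](_ : 4 = 2 * 2 :> R); last by ring.
by rewrite exprMn; apply/eqP; ring.
Qed.

Variables (S : {set binvec n}) (L : binvec n -> int).
Hypothesis Linj : injective L.

(** Transport along all [d.+1] directions at once, with [certified_count] as multiplicity bound. The
    absolute entries of a direction sum to at most those of its coefficients. *)
Lemma certified_mass (c : cert_type n d) (coef : nat -> nat -> int) :
  (valid_pattern c.1.2 -> forall r, (r < d.+1)%N -> forall j, (j <= d.+1)%N ->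
  \sum_(k < d.+1) coef r k * ((c.1.2 (inord j, k))%:R - (c.1.2 (ord_max, k))%:R) =
  (j <= r)%N%:R) ->
  \sum_(W : int_matrix n d N) matmass W * #|[pred x | `[<certified S L c W x>] ]|%:R <=
  (2 * n * N).+1%:R ^+ d.+1 *
    \prod_(r < d.+1) (\sum_(k < d.+1) `|coef r k|%:~R * tau).
Proof.
move=> coefP.
have tau0 := tau_ge0 (p_var ord0) n_gt0.
have rhs0 : 0 <= (2 * n * N).+1%:R ^+ d.+1 *
    \prod_(r < d.+1) (\sum_(k < d.+1) `|coef r k|%:~R * tau).
  rewrite mulr_ge0 ?exprn_ge0//; apply: prodr_ge0 => r _; apply: sumr_ge0 => k _.
  by rewrite mulr_ge0// ler0z.
(* A certificate that certifies nothing contributes zero; otherwise its pattern is valid and its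
   directions are nonzero. *)
have [[W0 [x0 c0]]|none] :=
  pselect (exists W : int_matrix n d N, exists x, certified S L c W x); last first.
  rewrite big1// => W _; rewrite eq_card0 ?mulr0// => x; rewrite !inE.
  by apply/asboolP => cx; apply: none; exists W, x.
have {}coefP := coefP (certified_valid c0).
have dir0 r : exists i, direction c coef r i != 0.
  apply/existsP; apply: contraT => /existsPn H.
  have := linval_direction_certified coefP r c0.
  have z y : linval (direction c coef r) y = 0.
    by rewrite /linval big1// => i _; have /negPn/eqP -> := H i; rewrite mul0r.
  by rewrite !z.
apply: le_trans (transport_prod_le (B := ((2 * n * N).+1 ^ d.+1)%N)
  (Sh := 'I_(2 * N).+1) (rho := fun r w s w' => shifted w (direction c coef r) s w')
  (q := fun r w => rowmass (p r) (row_coord w))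
  (D := fun r => mass_drop (p r) (direction c coef r))
  (E := fun W => #|[pred x | `[<certified S L c W x>] ]|) _ _ _ _) _.
- by move=> r w; apply: rowmass_ge0.
- by move=> r w; apply: mass_drop_ge0.
- by move=> r w; apply: (rowmass_transport (p_ge0 r) (p_supp r)).
- by move=> W'; apply: certified_count.
rewrite natrX; apply: ler_wpM2l; first exact: exprn_ge0.
apply: ler_prod => r _; apply/andP; split.
  by apply: sumr_ge0 => w _; apply: mass_drop_ge0.
apply: le_trans (sum_mass_drop N (p_ge0 r) (p_mass r) (p_var r) _) _.
rewrite -!mulr_suml; apply: ler_wpM2r => //.
rewrite -!(raddf_sum (intmul 1)) /= ler_int.
apply: (@le_trans _ _ (\sum_(i < n) \sum_(k < d.+1) `|coef r k| *+ (c.1.1 k == i))).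
  apply: ler_sum => i _; apply: le_trans (ler_norm_sum _ _ _) _.
  by apply: ler_sum => k _; rewrite normrMn.
rewrite exchange_big /=; apply: ler_sum => k _.
rewrite (bigD1 (c.1.1 k))//= eqxx big1 ?addr0// => i /negPf ne.
by rewrite eq_sym ne.
Qed.
End Discrete.

Lemma candidate_mass d : exists C : nat, forall (R : realFieldType) (n N : nat)
    (p : 'I_d.+1 -> 'I_n -> int -> R) (tau : R)
    (S : {set binvec n}) (L : binvec n -> int),
  (d < n)%N -> (0 < N)%N ->
  (forall r i k, 0 <= p r i k) ->
  (forall r i (k : int), N%:Z < `|k| -> p r i k = 0) ->
  (forall r i (a : int) (l : nat), \sum_(k < l) p r i (a + k%:Z) <= 1) ->
  (forall r i (a : int) (l : nat),
    \sum_(k < l) `|p r i (a + k%:Z) - p r i (a + k%:Z + 1)| <= tau) ->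
  injective L ->
  \sum_(W : int_matrix n d N) matmass p W *
     (separated W * #|[pred x | candidate S L W x]|)%N%:R <=
  C%:R * n%:R ^+ (2 * d.+1) * (N%:R * tau) ^+ d.+1.
Proof.
have [coef coefP] := coefficients_exist d.
(* [K] bounds the coefficient sums of all patterns at once. The indices contribute [n ^ d.+1],
   patterns and flags a constant, and the factor 3 comes from [2 n N + 1 <= 3 n N]. *)
pose K : nat := (\sum_(a : pattern d) \sum_(r < d.+1) \sum_(k < d.+1) `|coef a r k|)%N.
exists (#|pattern d| * #|{ffun 'I_d.+2 -> bool}| * (3 * K) ^ d.+1)%N.
move=> R n N p tau S L dn N0 p0 ps pm pv Linj.
have n0 : (0 < n)%N by lia.
have tau0 := tau_ge0 (pv ord0) n0.
apply: (@le_trans _ _ (\sum_(c : cert_type n d) \sum_(W : int_matrix n d N) matmass p W *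
    #|[pred x | `[<certified S L c W x>] ]|%:R)).
  rewrite exchange_big /=; apply: ler_sum => W _; rewrite -mulr_sumr.
  apply: ler_wpM2l; first exact: matmass_ge0.
  by rewrite -natr_sum ler_nat; apply: card_certified_cover.
apply: (@le_trans _ _ (\sum_(c : cert_type n d)
  ((3 * n * N)%N%:R * (K%:R * tau)) ^+ d.+1)).
  apply: ler_sum => c _.
  apply: le_trans (certified_mass n0 p0 ps pm pv S Linj (coefP c.1.2)) _.
  rewrite exprMn; apply: ler_pM.
  - exact: exprn_ge0.
  - apply: prodr_ge0 => r _; apply: sumr_ge0 => k _.
    by rewrite mulr_ge0// ler0z.
  - by rewrite lerXn2r ?nnegrE// ler_nat; nia.
  have -> : (K%:R * tau) ^+ d.+1 = \prod_(r < d.+1) (K%:R * tau).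
    by rewrite prodr_const card_ord.
  apply: ler_prod => r _; apply/andP; split.
    by apply: sumr_ge0 => k _; rewrite mulr_ge0// ler0z.
  rewrite -mulr_suml; apply: ler_wpM2r => //.
  have -> : \sum_(k < d.+1) `|coef c.1.2 r k|%:~R =
      (\sum_(k < d.+1) absz (coef c.1.2 r k))%N%:R :> R.
    by rewrite natr_sum; apply: eq_bigr => k _; rewrite -abszE.
  by rewrite ler_nat /K (bigD1 c.1.2)//= [in leqRHS](bigD1 r)//= -addnA leq_addr.
have cE : #|cert_type n d| = (n ^ d.+1 * (#|pattern d| * #|{ffun 'I_d.+2 -> bool}|))%N.
  by rewrite !card_prod card_ffun !card_ord mulnA.
rewrite sumr_const {}cE; move: (_ * #|_|)%N => M.
rewrite -[leLHS]mulr_natr !natrM !natrX exprM expr2 !natrM !exprMn le_eqVlt.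
by apply/orP; left; apply/eqP; ring.
Qed.

(** * Rounding the random coefficients *)

(** The rise, the fall and the two unconstrained steps at [c], the cell containing the mode, cost at
    most [M] each. *)
Lemma unimodal_variation (R : realFieldType) (g : int -> R) (M : R) (c : int) :
  (forall k, 0 <= g k <= M) ->
  (forall k, k + 1 < c -> g k <= g (k + 1)) ->
  (forall k, c < k -> g (k + 1) <= g k) ->
  forall (a : int) (l : nat),
    \sum_(k < l) `|g (a + k%:Z) - g (a + k%:Z + 1)| <= 4 * M.
Proof.
move=> g0 up down a l.
(* A nondecreasing potential whose increments dominate the variation of [g]. *)
pose G k := if k < c then g k else if k == c then 2 * M else 4 * M - g k.
have Gstep k : `|g k - g (k + 1)| <= G (k + 1) - G k.
  have /andP[k0 kM] := g0 k; have /andP[l0 lM] := g0 (k + 1).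
  rewrite /G; case: (ltgtP k c) => [kc|kc|kc].
  - have : k + 1 <= c by lia.
    rewrite le_eqVlt => /predU1P[e|kc1].
      by rewrite e ltxx eqxx ler_norml; rewrite e in l0 lM *; lra.
    rewrite kc1 distrC ger0_norm//; last by rewrite subr_ge0 up.
  - have -> : k + 1 < c = false by lia.
    have -> : (k + 1 == c) = false by lia.
    rewrite ger0_norm ?subr_ge0 ?down//; lra.
  - have -> : k + 1 < c = false by lia.
    have -> : (k + 1 == c) = false by lia.
    rewrite ler_norml; lra.
have G0 k : 0 <= G k <= 4 * M.
  have /andP[k0 kM] := g0 k; rewrite /G; case: ifP => _; [lra|case: ifP => _; lra].
apply: (@le_trans _ _ (G (a + l%:Z) - G a)); last first.
  by have := G0 a; have := G0 (a + l%:Z); lra.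
elim: l => [|l IH]; first by rewrite big_ord0 addr0 subrr.
rewrite big_ord_recr /=; apply: le_trans (lerD IH (Gstep _)) _.
by rewrite (_ : a + l.+1%:Z = a + l%:Z + 1); [lra|lia].
Qed.

Local Open Scope classical_set_scope.
Local Open Scope ring_scope.

(* Unlike in [ge0_le_integral], no measurability is required: the integral of a
   nonnegative function is a supremum over the simple functions below it. *)
Lemma ge0_le_integralT d (T : measurableType d) (R : realType)
    (mu : {measure set T -> \bar R}) (f g : T -> \bar R) :
  (forall x, (0 <= f x)%E) -> (forall x, (f x <= g x)%E) ->
  (\int[mu]_x f x <= \int[mu]_x g x)%E.
Proof.
move=> f0 fg; have g0 x : (0 <= g x)%E by apply: le_trans (fg x).
rewrite !ge0_integralTE//; apply: le_ereal_sup => _ [h hf <-].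
by exists h => // x; apply: le_trans (fg x).
Qed.

Section Cells.
Variables (R : realType) (N : nat).
Hypothesis N_gt0 : (0 < N)%N.

Definition cell (k : int) : set R := `[k%:~R / N%:R, (k + 1)%:~R / N%:R[.

Lemma cellP k x : cell k x <-> k%:~R <= x * N%:R < (k + 1)%:~R.
Proof.
rewrite /cell /= in_itv /= ler_pdivrMr ?ltr0n// ltr_pdivlMr ?ltr0n//.
Qed.

Lemma cell_floor x : cell (Num.floor (x * N%:R)) x.
Proof. by apply/cellP; rewrite floor_le floorD1_gt. Qed.

Lemma cell_disjoint k l x : cell k x -> cell l x -> k = l.
Proof.
move=> /cellP/andP[k1 k2] /cellP/andP[l1 l2].
have : k < l + 1 by rewrite -(ltr_int R); apply: le_lt_trans l2.
have : l < k + 1 by rewrite -(ltr_int R); apply: le_lt_trans k2.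
lia.
Qed.

Lemma measurable_cell k : measurable (cell k).
Proof. exact: measurable_itv. Qed.

Lemma lebesgue_cell k : lebesgue_measure (cell k) = (N%:R^-1)%:E.
Proof.
rewrite /cell lebesgue_measure_itv /= lte_fin ltr_pM2r ?invr_gt0 ?ltr0n//.
rewrite ltr_int (_ : k < k + 1); last lia.
by rewrite -EFinB -mulrBl intrD addrAC subrr add0r mul1r.
Qed.

Section Mass.
Variables (phi : R) (f : R -> R) (disp : measure_display) (T : measurableType disp).
Variables (P : probability T R) (X : {RV P >-> R}).
Hypothesis f_qc : quasiconcave_density phi f.
Hypothesis X_f : has_density X f.

Definition cell_mass (k : int) : R := fine (P (X @^-1` cell k)).

Lemma cell_massE k : (cell_mass k)%:E = P (X @^-1` cell k).
Proof.
rewrite /cell_mass fineK// fin_num_measure//.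
by apply: measurable_sfunP; apply: measurable_cell.
Qed.

Let I11 : set R := `[-1, 1].

Lemma mass_integral k :
  (cell_mass k)%:E = (\int[lebesgue_measure]_(x in I11 `&` cell k) (f x)%:E)%E.
Proof. by rewrite cell_massE -X_f//; apply: measurable_cell. Qed.

Lemma mass_ge0 k : 0 <= cell_mass k.
Proof. by rewrite fine_ge0. Qed.

Lemma mass_le k M : 0 <= M -> (forall x, I11 x -> cell k x -> f x <= M) ->
  cell_mass k <= M / N%:R.
Proof.
case: f_qc => mf f0 _ _ M0 fM; rewrite -lee_fin mass_integral.
have mI : measurable (I11 `&` cell k) by apply: measurableI; apply: measurable_itv.
apply: (@le_trans _ _ (\int[lebesgue_measure]_(x in I11 `&` cell k) (cst M%:E) x)%E).
  apply: ge0_le_integral => //.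
  - by move=> x [xI _]; rewrite lee_fin; have /andP[] := f0 x xI.
  - by apply/measurable_EFinP; apply: measurable_funS mf => // x [].
  - by move=> x [xI xk]; rewrite lee_fin fM.
rewrite integral_cst// EFinM -(lebesgue_cell k); apply: lee_wpmul2l => //.
apply: le_measure; [by rewrite inE|rewrite inE; exact: measurable_cell|by move=> x []].
Qed.

Lemma mass_ge k m : 0 <= m -> cell k `<=` I11 -> (forall x, cell k x -> m <= f x) ->
  m / N%:R <= cell_mass k.
Proof.
case: f_qc => mf f0 _ _ m0 kI mf'; rewrite -lee_fin mass_integral setIidr//.
apply: (@le_trans _ _ (\int[lebesgue_measure]_(x in cell k) (cst m%:E) x)%E).
  rewrite integral_cst; last exact: measurable_cell.
  by rewrite EFinM -(lebesgue_cell k).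
apply: ge0_le_integral => //.
- exact: measurable_cell.
- by apply/measurable_EFinP; apply: measurable_funS mf => //; apply: measurable_itv.
Qed.

Lemma mass_outside k : (forall x, I11 x -> ~ cell k x) -> cell_mass k = 0.
Proof.
move=> kI; apply/eqP; rewrite -eqe mass_integral.
rewrite (_ : I11 `&` cell k = set0) ?integral_set0//.
by apply/seteqP; split=> // x [/kI].
Qed.

Lemma mass_supp (k : int) : N%:Z < `|k| -> cell_mass k = 0.
Proof.
move=> Nk; apply: mass_outside => x; rewrite /I11 /= in_itv /=.
move=> /andP[x1 x2] /cellP/andP[k1 k2].
have NR : 0 < N%:R :> R by rewrite ltr0n.
have h1 : x * N%:R <= N%:R by rewrite ler_piMl// ltW.
have h2 : - N%:R <= x * N%:R by rewrite -mulN1r ler_wpM2r// ltW.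
have : k <= N%:Z by rewrite -(ler_int R); apply: le_trans h1.
have : - N%:Z < k + 1.
  by rewrite -(ltr_int R) intrN; apply: le_lt_trans k2.
by case: (ltrP 0 k) Nk => ?; lia.
Qed.

(** Cells are half-open, so this one meets the interval from -1 to 1 in the single point 1. *)
Lemma mass_N : cell_mass N%:Z = 0.
Proof.
apply/eqP; rewrite -eqe mass_integral.
rewrite (_ : I11 `&` cell N%:Z = [set 1]) ?integral_set1//.
have NR : 0 < N%:R :> R by rewrite ltr0n.
apply/seteqP; split=> [x []|x ->].
  rewrite /I11 /= in_itv /= => /andP[_ x1] /cellP/andP[k1 _].
  apply/eqP; rewrite eq_le x1 /=.
  by rewrite -(ler_pM2r NR) mul1r.
split; first by rewrite /I11 /= in_itv /= lexx andbT; lra.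
by apply/cellP; rewrite mul1r lexx -[ltLHS]/(N%:Z%:~R) ltr_int; lia.
Qed.

Lemma mass_le1 (a : int) (l : nat) : \sum_(k < l) cell_mass (a + k%:Z) <= 1.
Proof.
rewrite -lee_fin -sumEFin.
under eq_bigr do rewrite cell_massE.
have mX k : measurable (X @^-1` cell k).
  by apply: measurable_sfunP; apply: measurable_cell.
pose F (k : nat) := X @^-1` cell (a + k%:Z).
have mF k : measurable (F k) by exact: mX.
have tF : trivIset setT F.
  apply/trivIsetP => i j _ _ ij; apply/seteqP; split=> // w [wi wj].
  by have /addrI [e] := cell_disjoint wi wj; rewrite e eqxx in ij.
rewrite -(measure_bigsetU P mF tF); apply: probability_le1.
by apply: bigsetU_measurable => k _; apply: mF.
Qed.

Lemma cell_I11 k : - N%:Z <= k < N%:Z -> cell k `<=` I11.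
Proof.
move=> /andP[k1 k2] x /cellP/andP[x1 x2].
have NR : 0 < N%:R :> R by rewrite ltr0n.
rewrite /I11 /= in_itv /= -(ler_pM2r NR) -[x <= 1](ler_pM2r NR) mulN1r mul1r.
apply/andP; split.
  by apply: le_trans x1; rewrite -(ler_int R) intrN in k1.
apply: le_trans (ltW x2) _.
by rewrite -[N%:R]/(N%:Z%:~R) ler_int; lia.
Qed.

Lemma mass_variation (a : int) (l : nat) :
  \sum_(k < l) `|cell_mass (a + k%:Z) - cell_mass (a + k%:Z + 1)| <= 4 * (phi / N%:R).
Proof.
have NR : 0 < N%:R :> R by rewrite ltr0n.
case: f_qc => mf f0 f1 [c cI [up down]].
have phi0 : 0 <= phi by have /andP[] := f0 c cI; apply: le_trans.
have mle k : cell_mass k <= phi / N%:R.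
  by apply: mass_le => // x xI _; have /andP[] := f0 x xI.
have /andP[c1 c2] : -1 <= c <= 1 by move: cI; rewrite in_itv.
(* [c] lies in the cell [m]; across a boundary point [b] on
   either side of it, [f b] separates the values of [f] on the two cells. *)
have [m [mc cm]] : exists m : int, m%:~R <= c * N%:R /\ c * N%:R < (m + 1)%:~R.
  by exists (Num.floor (c * N%:R)); rewrite floor_le floorD1_gt.
apply: (@unimodal_variation _ _ _ m).
- by move=> k; rewrite mass_ge0 mle.
- move=> k kc.
  have [kN|Nk] := ltP k (- N%:Z).
    by rewrite mass_supp ?mass_ge0//; lia.
  have kc2 : (k + 2)%:~R <= c * N%:R.
    by apply: le_trans mc; rewrite ler_int; lia.
  have kN : k + 2 <= N%:Z.
    by rewrite -(ler_int R); apply: le_trans kc2 _; rewrite ler_piMl// ltW.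
  have cellk : cell k `<=` I11 by apply: cell_I11; lia.
  have cellk1 : cell (k + 1) `<=` I11 by apply: cell_I11; lia.
  pose b : R := (k + 1)%:~R / N%:R.
  have bc : cell (k + 1) b by apply/cellP; rewrite divfK ?gt_eqF// lexx ltr_int; lia.
  have bI : I11 b by exact: cellk1.
  have lec x : cell (k + 1) x -> x <= c.
    move=> /cellP/andP[_ x2]; rewrite -(ler_pM2r NR); apply: le_trans kc2.
    by apply: ltW; apply: lt_le_trans x2 _; rewrite ler_int; lia.
  have Ic x : I11 x -> x <= c -> x \in `[-1, c].
    by rewrite /I11 /= !in_itv /= => /andP[-> _] ->.
  have bIc := Ic _ bI (lec _ bc).
  have fb : 0 <= f b by have /andP[] := f0 b bI.
  apply: (@le_trans _ _ (f b / N%:R)).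
    apply: mass_le => // x xI /cellP/andP[_ x2].
    have xb : x <= b by rewrite /b ler_pdivlMr// ltW.
    by apply: up => //; apply: Ic => //; apply: le_trans xb (lec _ bc).
  apply: mass_ge => //.
  move=> x xk; apply: up => //.
    by apply: Ic (lec _ xk); apply: cellk1.
  by move/cellP: xk => /andP[x1 _]; rewrite /b ler_pdivrMr.
- move=> k ck.
  have ck2 : c * N%:R <= k%:~R.
    by apply: le_trans (ltW cm) _; rewrite ler_int; lia.
  have Nk : - N%:Z <= k.
    rewrite -(ler_int R); apply: le_trans ck2; rewrite intrN -mulN1r.
    by rewrite ler_wpM2r// ltW.
  (* From [k = N - 1] on, the mass of cell [k + 1] vanishes. *)
  have [kN|kN] := ltP k (N%:Z - 1); last first.
    move: kN; rewrite le_eqVlt => /predU1P[<-|kN].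
      by rewrite subrK mass_N mass_ge0.
    have [e|Nk1] := eqVneq k N%:Z.
      by rewrite [cell_mass (k + 1)]mass_supp ?mass_ge0// e; lia.
    by rewrite [cell_mass (k + 1)]mass_supp ?mass_ge0//; lia.
  have cellk : cell k `<=` I11 by apply: cell_I11; lia.
  have cellk1 : cell (k + 1) `<=` I11 by apply: cell_I11; lia.
  pose b : R := (k + 1)%:~R / N%:R.
  have bc : cell (k + 1) b by apply/cellP; rewrite divfK ?gt_eqF// lexx ltr_int; lia.
  have bI : I11 b by exact: cellk1.
  have gec x : cell k x -> c <= x.
    by move=> /cellP/andP[x1 _]; rewrite -(ler_pM2r NR); apply: le_trans x1.
  have cb : c <= b.
    by rewrite /b ler_pdivlMr//; apply: le_trans ck2 _; rewrite ler_int; lia.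
  have Ic x : I11 x -> c <= x -> x \in `[c, 1].
    by rewrite /I11 /= !in_itv /= => /andP[_ ->] ->.
  have bIc := Ic _ bI cb.
  have fb : 0 <= f b by have /andP[] := f0 b bI.
  apply: (@le_trans _ _ (f b / N%:R)).
    apply: mass_le => // x xI /cellP/andP[x1 _].
    have xb : b <= x by rewrite /b ler_pdivrMr.
    by apply: down => //; apply: Ic => //; apply: le_trans cb xb.
  apply: mass_ge => //.
  move=> x xk; apply: down => //.
    by apply: Ic (gec _ xk); apply: cellk.
  by move/cellP: xk => /andP[_ x2]; rewrite /b ler_pdivlMr// ltW.
Qed.

End Mass.
End Cells.

(** * The expected number of Pareto-optimal solutions *)

(** [L] is the position in an enumeration sorted by [v]; breaking ties arbitrarily preserves strict
    comparisons. *)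
Lemma injective_ranking (R : realDomainType) (T : finType) (v : T -> R) :
  exists2 L : T -> int, injective L & forall x z, v x < v z -> L x < L z.
Proof.
pose leT a b := v a <= v b.
pose s := sort leT (enum T).
have ins x : x \in s by rewrite mem_sort mem_enum.
have ssort : sorted leT s by apply: sort_sorted => a b; apply: le_total.
exists (fun x => (index x s)%:Z) => [x z [] /index_inj|x z vxz]; first exact.
rewrite ltz_nat ltnNge; apply/negP => zx.
have ltr : transitive leT by move=> a b c; apply: le_trans.
have := sorted_leq_nth ltr (fun a => lexx (v a)) x ssort.
move=> /(_ (index z s) (index x s)); rewrite !inE !index_mem => /(_ (ins z) (ins x) zx).
by rewrite !nth_index// /leT leNgt vxz.
Qed.

Section Pointwise.
Variables (R : realType) (n d N : nat).
Hypothesis N_gt0 : (0 < N)%N.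
Variables (S : {set binvec n}) (Vlast : binvec n -> R).
Variables (L : binvec n -> int).
Hypothesis L_mono : forall x z, Vlast x < Vlast z -> L x < L z.

(** After scaling by [N], each coefficient exceeds its grid value by less than 1, so the difference
    of the two objectives moves by at most [n]. *)
Lemma row_order (v : 'I_n -> R) (w : int_row n N) (z x : binvec n) :
  (forall i, cell N (coord (w i)) (v i)) ->
  linval (row_coord w) z - linval (row_coord w) x < - n%:Z ->
  \sum_i v i * (z i)%:R < \sum_i v i * (x i)%:R.
Proof.
move=> vw lzx; rewrite -subr_lt0 -sumrB.
have NR : 0 < N%:R :> R by rewrite ltr0n.
rewrite -(pmulr_llt0 _ NR) mulr_suml.
have lR : (linval (row_coord w) z - linval (row_coord w) x)%:~R < - n%:R :> R.
  by rewrite -[n%:R]/(n%:Z%:~R) -intrN ltr_int.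
apply: le_lt_trans (_ : _ <=
  (linval (row_coord w) z - linval (row_coord w) x)%:~R + n%:R) _; last lra.
rewrite (_ : n%:R = \sum_(i < n) 1 :> R); last by rewrite sumr_const card_ord.
rewrite /linval -sumrB (raddf_sum (intmul 1)) /= -big_split /=.
apply: ler_sum => i _; have /cellP -/(_ N_gt0)/andP[] := vw i; rewrite /row_coord intrD.
set c := (coord (w i))%:~R => c1 c2.
rewrite intrB !intrM -/c.
by case: (z i); case: (x i); rewrite /= ?mulr0z ?mulr1z ?mulr1 ?mulr0; lra.
Qed.

(** By separation, a [z] that beats [x] in all rounded rows beats it in all true linear objectives;
    were its last objective no larger, it would dominate [x]. *)
Lemma pareto_candidate (V : 'M[R]_(d.+1, n)) (W : int_matrix n d N) x :
  (forall r i, cell N (coord (W r i)) (V r i)) -> separated W ->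
  pareto_optimal S V Vlast x -> candidate S L W x.
Proof.
move=> VW sW /andP[xS /exists_inPn nd]; rewrite /candidate xS /=.
apply/forall_inP => z zS; apply/implyP => /forallP lt.
have ltV r : \sum_i V r i * (z i)%:R < \sum_i V r i * (x i)%:R.
  apply: (row_order (VW r)); have lr := lt r.
  have zx : z != x by apply: contraTneq lr => ->; rewrite ltxx.
  have := forallP (forallP (forallP sW r) z) x; rewrite zx /=.
  by rewrite ltr0_norm ?subr_lt0//; lia.
apply/ltW/L_mono; rewrite ltNge; apply: contra (nd z zS) => le; apply/andP; split.
  apply/forallP => t; rewrite /objective; case: unliftP => [r _|_] //.
  exact/ltW/ltV.
by apply/existsP; exists (lift ord_max ord0); rewrite /objective liftK; apply: ltV.
Qed.

Lemma PO_le_2n (V : 'M[R]_(d.+1, n)) : (PO S Vlast V <= 2 ^ n)%N.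
Proof. by apply: leq_trans (max_card _) _; rewrite card_ffun card_bool card_ord. Qed.

Lemma PO_le (V : 'M[R]_(d.+1, n)) (W : int_matrix n d N) :
  (forall r i, cell N (coord (W r i)) (V r i)) ->
  (PO S Vlast V <=
   separated W * #|[pred x | candidate S L W x]| + 2 ^ n * ~~ separated W)%N.
Proof.
move=> VW; case: (boolP (separated W)) => sW /=; last by rewrite mul0n muln1 PO_le_2n.
rewrite mul1n muln0 addn0; apply: subset_leq_card; apply/fintype.subsetP => x.
by rewrite !inE => /(pareto_candidate VW sW).
Qed.

End Pointwise.

Lemma integral_simple d (T : measurableType d) (R : realType)
    (mu : {finite_measure set T -> \bar R}) (J : finType) (a : J -> R) (A : J -> set T) :
  (forall j, 0 <= a j) -> (forall j, measurable (A j)) ->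
  (\int[mu]_w (\sum_j a j * \1_(A j) w)%:E = (\sum_j a j * fine (mu (A j)))%:E)%E.
Proof.
move=> a0 mA.
have mI j : measurable_fun setT (fun w => (\1_(A j) w : R)%:E).
  by apply/measurable_EFinP; exact: measurable_indic.
have mf j : measurable_fun setT (fun w => (a j * \1_(A j) w)%:E).
  by apply/measurable_EFinP; apply: measurable_funM => //; exact: measurable_indic.
under eq_integral => w _ do rewrite -sumEFin.
rewrite ge0_integral_sum//; last by move=> j w _; rewrite lee_fin mulr_ge0.
rewrite -sumEFin; apply: eq_bigr => j _.
under eq_integral => w _ do rewrite EFinM.
rewrite ge0_integralZl_EFin//.
by rewrite integral_indic// setIT EFinM fineK// fin_num_measure.
Qed.

Section Expectation.
Variables (R : realType) (n d N : nat) (phi : R).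
Variables (S : {set binvec n}) (Vlast : binvec n -> R).
Variables (f : 'I_d.+1 -> 'I_n -> R -> R) (disp : measure_display).
Variables (T : measurableType disp) (P : probability T R).
Variables (V : 'I_d.+1 -> 'I_n -> {RV P >-> R}).
Hypothesis f_qc : forall t i, quasiconcave_density phi (f t i).
Hypothesis V_f : forall t i, has_density (V t i) (f t i).
Hypothesis V_ind : mutually_independent (fun ti : 'I_d.+1 * 'I_n => V ti.1 ti.2).

Let EPO := ('E_P[fun w => (PO S Vlast (\matrix_(t, i) V t i w))%:R])%E.

Lemma expectation_PO_le_2n : (EPO <= (2 ^+ n)%:E)%E.
Proof.
rewrite /EPO -(expectation_cst P (2 ^+ n)) unlock.
apply: ge0_le_integralT => w; rewrite lee_fin//.
by rewrite /cst -natrX ler_nat PO_le_2n.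
Qed.

Hypothesis N_gt0 : (0 < N)%N.
Variables (L : binvec n -> int).
Hypothesis L_mono : forall x z, Vlast x < Vlast z -> L x < L z.

Definition pmass r i := cell_mass N (V r i).

Definition box (W : int_matrix n d N) : set T :=
  \bigcap_(ti in [set` [set: 'I_d.+1 * 'I_n]%SET])
    (V ti.1 ti.2 @^-1` cell N (coord (W ti.1 ti.2))).

Lemma measurable_box W : measurable (box W).
Proof.
apply: fin_bigcap_measurable => // ti _.
by apply: measurable_sfunP; apply: measurable_cell.
Qed.

Lemma box_mass W : fine (P (box W)) = matmass pmass W.
Proof.
rewrite /box (V_ind [set: _]%SET (A := fun ti => cell N (coord (W ti.1 ti.2)))); last first.
  by move=> ti; apply: measurable_cell.
rewrite (eq_bigr (fun ti => (pmass ti.1 ti.2 (coord (W ti.1 ti.2)))%:E)); last first.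
  by move=> ti _; rewrite cell_massE.
rewrite prodEFin /= /matmass /rowmass pair_big /=; apply: eq_bigl => ti.
by rewrite inE.
Qed.

(** The coefficients are bounded by 1 only almost surely; off these null events the grid cells cover
    them. *)
Definition outside (ti : 'I_d.+1 * 'I_n) : set T :=
  V ti.1 ti.2 @^-1` (~` `[-1, 1]).

Lemma measurable_outside ti : measurable (outside ti).
Proof. by apply: measurable_sfunP; apply: measurableC; apply: measurable_itv. Qed.

Lemma outside_null ti : P (outside ti) = 0%E.
Proof.
have := V_f ti.1 ti.2 (measurableC (measurable_itv `[(-1)%R, 1%R])).
by rewrite setICr integral_set0.
Qed.

(** [PO] is dominated pointwise by a simple function built from the bound of [PO_le] on each box and
    [2 ^ n] on the null events. *)
Lemma expectation_PO_le :
  (EPO <= (\sum_(W : int_matrix n d N) matmass pmass W *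
             (separated W * #|[pred x | candidate S L W x]|)%N%:R +
           2 ^+ n * \sum_(W : int_matrix n d N) matmass pmass W * (~~ separated W)%:R)%:E)%E.
Proof.
pose g (W : int_matrix n d N) : nat :=
  (separated W * #|[pred x | candidate S L W x]| + 2 ^ n * ~~ separated W)%N.
pose a (j : int_matrix n d N + 'I_d.+1 * 'I_n) : R :=
  match j with inl W => (g W)%:R | inr _ => 2 ^+ n end.
pose A (j : int_matrix n d N + 'I_d.+1 * 'I_n) : set T :=
  match j with inl W => box W | inr ti => outside ti end.
have a0 j : 0 <= a j by case: j => [W|ti] /=; rewrite ?exprn_ge0.
have mA j : measurable (A j).
  by case: j => [W|ti]; [apply: measurable_box|apply: measurable_outside].
rewrite /EPO unlock.
apply: (@le_trans _ _ (\int[P]_w (\sum_j a j * \1_(A j) w)%:E)%E).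
  apply: ge0_le_integralT => w; rewrite lee_fin//.
  have pos j : 0 <= a j * \1_(A j) w by rewrite mulr_ge0.
  have one j : A j w -> a j <= \sum_j a j * \1_(A j) w.
    move=> Aw; rewrite (bigD1 j)//= indicE mem_set// mulr1 lerDl.
    by apply: sumr_ge0.
  have [[ti out]|inI] := pselect (exists ti, outside ti w).
    apply: le_trans (one (inr ti) out); rewrite /a -natrX ler_nat.
    exact: PO_le_2n.
  have VI r i : V r i w \in `[-1, 1].
    by apply: contrapT => h; apply: inI; exists (r, i).
  pose W : int_matrix n d N := [ffun r => [ffun i =>
    inord (absz (Num.floor (V r i w * N%:R) + N%:Z))]].
  have cW r i : cell N (coord (W r i)) (V r i w).
    have c := cell_floor N_gt0 (V r i w).
    move: c (VI r i); rewrite !ffunE.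
    move: (Num.floor _) => k /[dup] /(cellP N_gt0)/andP[k1 k2] c.
    rewrite in_itv /= => /andP[v1 v2].
    have NR : 0 < N%:R :> R by rewrite ltr0n.
    have kN : k <= N%:Z.
      by rewrite -(ler_int R); apply: le_trans k1 _; rewrite ler_piMl// ltW.
    have Nk : - N%:Z < k + 1.
      rewrite -(ltr_int R); apply: le_lt_trans k2; rewrite intrN -mulN1r.
      by rewrite ler_wpM2r// ltW.
    rewrite (_ : coord _ = k)// /coord inordK; lia.
  apply: le_trans (one (inl W) _); last by move=> ti _; apply: cW.
  rewrite /a /g ler_nat; apply: PO_le => // r i; rewrite mxE; exact: cW.
rewrite integral_simple// lee_fin big_sumType /=.
rewrite [X in _ + X]big1 ?addr0; last first.
  by move=> ti _; rewrite outside_null mulr0.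
rewrite mulr_sumr -big_split /=; apply: ler_sum => W _.
by rewrite box_mass /g natrD !natrM natrX le_eqVlt; apply/orP; left; apply/eqP; ring.
Qed.

End Expectation.

Local Close Scope classical_set_scope.

Theorem theorem2 (R : realType) (d : nat) (hd : (1 <= d)%N) :
  exists C : R, forall (n : nat) (phi : R), (1 <= n)%N -> 1 <= phi ->
    (smoothed_number_PO d n phi <= (C * n%:R ^+ (2 * d) * phi ^+ d)%:E)%E.
Proof.
case: d hd => // d _.
have [C HC] := candidate_mass d.
(* The three terms pay for the candidates, with [tau = 4 phi / N], for the non-separated matrices,
   and for the case [n <= d], where [2 ^ n] suffices. *)
exists (C%:R * 4 ^+ d.+1 + 1 + 2 ^+ d) => n phi n0 phi1.
apply: ge_ereal_sup => _ [S [Vlast [f [disp [T [P [V [fqc Vf Vind ->]]]]]]]].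
have phi0 : 0 <= phi by apply: le_trans phi1.
have C0 : 0 <= C%:R * 4 ^+ d.+1 :> R by rewrite mulr_ge0// exprn_ge0.
have [M ME] : exists M, M = n%:R ^+ (2 * d.+1) * phi ^+ d.+1 by eexists.
have M1 : 1 <= M.
  by rewrite ME -[leLHS]mulr1 ler_pM// exprn_ege1// ler1n.
rewrite -mulrA -ME.
have [dn|nd] := ltnP d n; last first.
  apply: le_trans (expectation_PO_le_2n S Vlast V) _.
  rewrite lee_fin -[leLHS]mulr1 ler_pM ?exprn_ge0//.
  by rewrite (le_trans (_ : _ <= 2 ^+ d)) ?ler_weXn2l ?ler1n// lerDr; lra.
have [L Linj Lmono] := injective_ranking Vlast.
(* [K / N] bounds the contribution of the non-separated matrices, so [N >= K] makes it at most 1. *)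
pose K : R := 2 ^+ n * (d.+1%:R * 4 ^+ n * (2 * n).+1%:R * (4 * phi)).
have [N [N0 KN]] : exists N : nat, (0 < N)%N /\ K <= N%:R.
  exists (Num.bound K); have K0 : 0 <= K.
    by rewrite !mulr_ge0 ?exprn_ge0.
  have KN := archi_boundP K0.
  split; last exact: ltW.
  by rewrite -(ltr_nat R); apply: le_lt_trans KN.
apply: le_trans (expectation_PO_le S Vf Vind N0 Lmono) _.
have NR : 0 < N%:R :> R by rewrite ltr0n.
have p0 r i k : 0 <= pmass N V r i k by apply: mass_ge0.
have ps r i (k : int) : N%:Z < `|k| -> pmass N V r i k = 0.
  exact: (mass_supp N0 (Vf r i)).
have pm r i := mass_le1 N0 (V r i).
have pv r i := mass_variation N0 (fqc r i) (Vf r i).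
rewrite lee_fin mulrDl mulrDl; apply: ler_wpDr.
  by rewrite mulr_ge0 ?exprn_ge0//; lra.
apply: lerD.
  apply: le_trans (HC R n N _ _ S L dn N0 p0 ps pm pv Linj) _.
  rewrite ME (_ : N%:R * _ = 4 * phi) ?exprMn; last by field; rewrite gt_eqF.
  by rewrite le_eqVlt; apply/orP; left; apply/eqP; ring.
rewrite mul1r; apply: (le_trans _ M1).
apply: le_trans (ler_wpM2l _ (not_separated_mass n0 p0 ps pm pv)) _.
  exact: exprn_ge0.
rewrite [leLHS](_ : _ = K / N%:R); last first.
  by rewrite /K; ring.
by rewrite ler_pdivrMr// mul1r.
Qed.
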